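(* Let $p$ be a prime, let $s\ge 1$, let $\Psi=(\psi_1,\ldots,\psi_s)\in\mathbb{F}_p(X)^s$ be rational functions, each of degree $d\ge 2$, and let $u\in\mathbb{F}_p$. Then for $N\le T_{\Psi,u}$ and any integer $\nu\ge 1$ we have $$L_{\Psi,u}(N)\gg_{s,d,\nu}\min\left\{N^{d^\nu+o(1)},\ p^{1/(2d^{2\nu}+d^\nu-1/2)}\right\}.$$
   Context: $\mathbb{F}_p$ is the finite field of $p$ elements, represented by the integers $\{0,1,\ldots,p-1\}$. The degree of a rational function $f/g$ with coprime $f,g\in\mathbb{F}_p[X]$ is $\max\{\deg f,\deg g\}$. A path originating from $u\in\mathbb{F}_p$ is any sequence $\{u_n\}$ of elements of $\mathbb{F}_p$ with $$u_0=u,\qquad u_{n+1}=\psi_{j_n}(u_n),\quad n=0,1,\ldots,$$ with arbitrary $j_n\in\{1,\ldots,s\}$ (the values $\psi_{j_n}(u_n)$ being defined). $\Pi_{\Psi,u}$ is the set of all paths originating from $u$. $T_{\Psi,u}$ is the largest positive integer $T$ such that in any path $\{u_n\}\in\Pi_{\Psi,u}$ the first $T$ elements are pairwise distinct. For a positive integer $N$, $$L_{\Psi,u}(N)=\min_{\{u_n\}\in\Pi_{\Psi,u}}\ \min_{v\in\mathbb{F}_p}\ \max_{0\le n\le N}|u_n-v|,$$ where $|u_n-v|$ is computed with the integer representatives in $\{0,1,\ldots,p-1\}$. The notation $U\gg_{s,d,\nu}V$ means $|V|\le cU$ for some constant $c>0$ depending only on $s,d,\nu$. The term $o(1)$ denotes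 a quantity tending to $0$ as $N\to\infty$ for fixed $s,d,\nu$, uniformly in $p$, $\Psi$ and $u$.
   Formalization: The case T_{Ψ,u} = 1 is excluded: there only N = 1 is admissible, some path has u_1 = u_0 (e.g. ψ = X², u = 0), so L_{Ψ,u}(1) = 0 while the minimum on the right is 1, and the bound fails. *)

(* Defs.v *)
From HB Require Import structures.
From mathcomp Require Import all_boot all_order all_algebra.
From mathcomp Require Import all_classical all_reals all_analysis.

Set Implicit Arguments.
Unset Strict Implicit.
Unset Printing Implicit Defensive.

Import Order.TTheory GRing.Theory Num.Theory.
Local Open Scope classical_set_scope.
Local Open Scope ring_scope.

(* The representative [repr q] of a fraction need not be in lowest terms, so
   numerator and denominator are divided by their gcd; the resulting coprime
   pair is determined by [q] up to a common nonzero constant. *)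
Definition rnum (F : fieldType) (q : {fraction {poly F}}) : {poly F} :=
  let r := frac (repr q) in r.1 %/ gcdp r.1 r.2.

Definition rden (F : fieldType) (q : {fraction {poly F}}) : {poly F} :=
  let r := frac (repr q) in r.2 %/ gcdp r.1 r.2.

Definition ratdeg (F : fieldType) (q : {fraction {poly F}}) : nat :=
  maxn (size (rnum q)).-1 (size (rden q)).-1.

Definition rateval_def (F : fieldType) (q : {fraction {poly F}}) (x : F) :
  bool := ~~ root (rden q) x.

Definition rateval (F : fieldType) (q : {fraction {poly F}}) (x : F) : F :=
  (rnum q).[x] / (rden q).[x].

Lemma ratio_lowest (F : fieldType) (f g : {poly F}) :
    g != 0 -> coprimep f g ->
  let q := FracField.tofrac f / FracField.tofrac g in
  exists2 a : F, a != 0 & rnum q = a *: f /\ rden q = a *: g.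
Proof.
move=> g0 cfg q; have r20 := denom_ratioP (repr q).
set r := frac (repr q) in r20.
have qE : FracField.tofrac r.1 = q * FracField.tofrac r.2.
  rewrite -{1}[q]reprK /r; case: (repr q) => -[n m] /= m0; rewrite !piE.
  apply/eqmodP; rewrite /= FracField.equivfE /FracField.mulf.
  by rewrite !numden_Ratio ?oner_eq0 ?mulr1 ?mul1r //= mulrC.
have cross : r.1 * g = f * r.2.
  apply/eqP; rewrite -tofrac_eq !rmorphM /= qE /q mulrAC.
  by rewrite -[X in X * _ == _]mulrA mulVf ?tofrac_eq0 // mulr1.
have gr : g %| r.2.
  by rewrite -(Gauss_dvdpr _ (_ : coprimep g f)) 1?coprimep_sym // -cross dvdp_mull.
have r2E : r.2 = (r.2 %/ g) * g by rewrite divpK.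
set h := r.2 %/ g in r2E.
have r1E : r.1 = h * f.
  by apply: (mulIf g0); rewrite cross {1}r2E mulrCA mulrA.
have h0 : h != 0 by apply: contraNneq r20; rewrite r2E => ->; rewrite mul0r.
have : gcdp r.1 r.2 %= h.
  rewrite r1E r2E; apply: eqp_trans (_ : h * gcdp f g %= h).
    by rewrite eqp_sym mulp_gcdr.
  by rewrite -{2}[h]mulr1 eqp_mul2l // -/(coprimep f g) gcdp_eqp1.
case/eqpP=> -[b c] /= /andP[b0 c0] bch.
have k0 : gcdp r.1 r.2 != 0.
  by apply: contraNneq h0 => k0; move/esym/eqP: bch;
    rewrite k0 scaler0 scaler_eq0 (negPf c0).
have hE : h = (b / c) *: gcdp r.1 r.2.
  by rewrite mulrC -scalerA bch scalerA mulVf // scale1r.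
exists (b / c); first by rewrite mulf_neq0 ?invr_eq0.
split.
  by rewrite /rnum -/r {1}r1E hE -scalerAl divpZl mulKp.
by rewrite /rden -/r {1}r2E hE -scalerAl divpZl mulKp.
Qed.

Definition is_path (p s : nat) (Psi : 'I_s -> {fraction {poly 'F_p}})
    (u : 'F_p) (x : nat -> 'F_p) : Prop :=
  x 0%N = u /\
  forall n, exists j : 'I_s,
    rateval_def (Psi j) (x n) /\ x n.+1 = rateval (Psi j) (x n).

(* Junk value [0] if [A] has no greatest (resp. least) element. *)
Definition greatest (A : set nat) : nat := xget 0%N (A `&` ubound A).
Definition least (A : set nat) : nat := xget 0%N (A `&` lbound A).

(* If no (infinite) path originates from [u], every [T] qualifies and there is
   no largest one; [Tpath] is then [0]. *)
Definition Tpath (p s : nat) (Psi : 'I_s -> {fraction {poly 'F_p}})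
    (u : 'F_p) : nat :=
  greatest [set T | (0 < T)%N /\
                    forall x, is_path Psi u x -> uniq (mkseq x T)].

(* The coercion ['F_p >-> nat] is the representative in [{0, ..., p - 1}]
   when [p] is prime. *)
Definition repdist (p : nat) (x y : 'F_p) : nat :=
  `|(x : nat)%:Z - (y : nat)%:Z|%N.

Definition Lpath (p s : nat) (Psi : 'I_s -> {fraction {poly 'F_p}})
    (u : 'F_p) (N : nat) : nat :=
  least [set m | exists x (v : 'F_p),
    is_path Psi u x /\ m = (\max_(n < N.+1) repdist (x n) v)%N].

Lemma TpathP (p s : nat) (Psi : 'I_s -> {fraction {poly 'F_p}}) (u : 'F_p) :
    (exists x, is_path Psi u x) ->
  [/\ (0 < Tpath Psi u)%N,
      forall x, is_path Psi u x -> uniq (mkseq x (Tpath Psi u))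
    & forall T, (0 < T)%N ->
        (forall x, is_path Psi u x -> uniq (mkseq x T)) ->
        (T <= Tpath Psi u)%N].
Proof.
move=> [x px]; rewrite /Tpath /greatest.
set A := [set T | _].
have bA T : A T -> (T <= #|'F_p|)%N.
  by case=> _ /(_ _ px) /card_uniqP cT; rewrite -(size_mkseq x T) -cT max_card.
have exA : exists T, `[< A T >] by exists 1%N; apply/asboolP.
have bA' T : `[< A T >] -> (T <= #|'F_p|)%N by move=> /asboolP /bA.
case: (ex_maxnP exA bA') => m /asboolP Am maxm.
have [[T0 TU] Tub] : (A `&` ubound A) (xget 0%N (A `&` ubound A)).
  by apply: xgetPex; exists m; split=> // T AT; apply: maxm; apply/asboolP.
by split=> // T T1 T2; apply: Tub.
Qed.

Lemma LpathP (p s : nat) (Psi : 'I_s -> {fraction {poly 'F_p}}) (u : 'F_p)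
    (N : nat) :
    (exists x, is_path Psi u x) ->
  (exists x (v : 'F_p), is_path Psi u x /\
     Lpath Psi u N = (\max_(n < N.+1) repdist (x n) v)%N) /\
  (forall x (v : 'F_p), is_path Psi u x ->
     (Lpath Psi u N <= \max_(n < N.+1) repdist (x n) v)%N).
Proof.
move=> [x px]; rewrite /Lpath /least; set A := [set m | _].
have exA : exists m, `[< A m >].
  by exists (\max_(n < N.+1) repdist (x n) 0%R)%N; apply/asboolP; exists x, 0.
case: (ex_minnP exA) => m /asboolP Am minm.
have [Al lA] : (A `&` lbound A) (xget 0%N (A `&` lbound A)).
  by apply: xgetPex; exists m; split=> // k Ak; apply: minm; apply/asboolP.
by split=> // y v py; apply: lA; exists y, v.
Qed.

(* Main.v *)
Require Import Defs.
From HB Require Import structures.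
From mathcomp Require Import all_boot all_order all_algebra.
From mathcomp Require Import all_classical all_reals all_analysis.
From mathcomp Require Import closed_field.
From mathcomp Require Import zify ring lra.
Import Order.TTheory GRing.Theory Num.Theory numFieldNormedType.Exports.
Local Open Scope classical_set_scope.
Local Open Scope ring_scope.

Set Implicit Arguments.
Unset Strict Implicit.
Unset Printing Implicit Defensive.

(** Put D = d ^ nu, and let L be the distance to v reached by a path
    u_0, ..., u_N.  The pairs (u_n - v, u_(n + nu) - v) lie in the box
    [-L, L]^2, and each of them lies on the graph modulo p of a composition of
    nu of the psi_j, conjugated by the translation by v.  There are at most
    s ^ nu such compositions, each of degree D ([lowest_terms_comp]), so one
    of them carries at least (N - nu) / s ^ nu points with distinct abscissas
    ([path_on_curve]).  Everything therefore rests on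
    [curve_points_bound]: a graph y = f(x) / g(x) of degree D over a field of
    characteristic p meets the box in at most L ^ (1 / D + o(1)) points, as
    long as (2 D + 2)! L ^ ((D + 1) ^ 2) < p.

    That bound comes from lifting the graph to the integers.  The 2 D + 2
    monomials x ^ i and y x ^ i, for i <= D, are linearly dependent modulo p on
    the points, so the determinants of size 2 D + 2 that they form vanish modulo
    p; being smaller than p they vanish.  Their cofactors give integer
    polynomials A and B, with coefficients polynomial in L, such that
    A(x) + y B(x) = 0 at all the points and (A, B) is proportional to (f, - g)
    modulo p ([lift_relation]).  Two cases remain.

    - B is not constant.  The Sylvester determinant r of (A, B) is nonzero since
      it is nonzero modulo p, it is polynomial in L, and r = U A + V B.  At a
      point this makes B(x) a divisor of r, so the divisor bound
      leaves L ^ o(1) values of B(x), hence L ^ o(1) values of x.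
    - B is a constant c.  Then A has degree D, and c divides A(x) with
      a quotient bounded by L.  Lagrange interpolation used q-adically, for each
      prime q dividing c, shows that the abscissas fall into at most
      D ^ omega(c) = L ^ o(1) classes to a modulus m with m ^ D >= c
      ([root_class]).  Lagrange interpolation used with the usual absolute
      value shows that one class contains O(L ^ (1 / D)) of them, as A is of
      size at most c L on points that are m apart ([lead_coef_spread]).

    Hence N ^ (k D) <= C_k L ^ (k + 1) for every k ([path_length_bound]), which
    is the claim once all k are merged into one o(1) ([uniform_exponent]).
    The condition on L and p holds whenever L is less than a small multiple of
    p ^ (1 / (2 D ^ 2 + D - 1 / 2)), because
    (D + 1) ^ 2 <= 2 D ^ 2 + D - 1 / 2 for D >= 2. *)

(** * The divisor bound *)

Lemma size_divisors (n : nat) :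
  size (divisors n) = (\prod_(q <- primes n) (logn q n).+1)%N.
Proof.
have add_size f ds : size (PrimeDecompAux.add_divisors f ds) = (f.2.+1 * size ds)%N.
  case: f => q e; rewrite /PrimeDecompAux.add_divisors /=.
  elim: e => [|e IHe]; first by rewrite mul1n.
  by rewrite iterS size_merge size_cat size_map IHe [RHS]mulSn addnC.
rewrite /divisors prime_decompE; elim: (primes n) => [|q qs IH] /=.
  by rewrite big_nil.
by rewrite (add_size (q, logn q n)) IH big_cons.
Qed.

Lemma prod_primes_logn (n : nat) :
  (0 < n)%N -> (\prod_(q <- primes n) q ^ logn q n)%N = n.
Proof.
by move=> n0; rewrite {3}(prod_prime_decomp n0) prime_decompE big_map.
Qed.

Lemma leq_expn2r (a b e : nat) : (a <= b)%N -> (a ^ e <= b ^ e)%N.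
Proof. by case: e => [|e] ab; rewrite ?expn0 // leq_exp2r. Qed.

(** Apply m + 1 <= 2 ^ m to m = e %/ k, and use e + 1 <= k (m + 1). *)
Lemma expn_succ_le (k e : nat) : (0 < k)%N -> (e.+1 ^ k <= k ^ k * 2 ^ e)%N.
Proof.
move=> k0; apply: (@leq_trans ((k * 2 ^ (e %/ k)) ^ k)).
  rewrite leq_exp2r //; apply: leq_trans (ltn_ceil e k0) _.
  by rewrite mulnC leq_pmul2l // ltn_expl.
by rewrite expnMn -expnM leq_pmul2l ?expn_gt0 ?k0 // leq_pexp2l // leq_divM.
Qed.

(** Writing n as the product of the q ^ e, the quotient of the two sides is a
    product of factors (e + 1) ^ k / q ^ e.  These are at most 1 once
    q >= 2 ^ k, and there are fewer than 2 ^ k smaller primes, each contributing at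
    most k ^ k. *)
Lemma divisor_bound (k : nat) :
  exists2 C : nat, (0 < C)%N &
    forall n, (0 < n)%N -> (size (divisors n) ^ k <= C * n)%N.
Proof.
case: k => [|k']; first by exists 1%N => // n; rewrite expn0 mul1n.
set k := k'.+1; pose B := (k ^ k)%N.
have B0 : (0 < B)%N by rewrite expn_gt0.
exists (B ^ (2 ^ k))%N; first by rewrite expn_gt0 B0.
move=> n n0; rewrite size_divisors.
have -> : ((\prod_(q <- primes n) (logn q n).+1) ^ k
           = \prod_(q <- primes n) (logn q n).+1 ^ k)%N.
  by apply: (big_morph (fun m => (m ^ k)%N)) => [x y|]; rewrite ?expnMn ?exp1n.
pose b q := if (q < 2 ^ k)%N then B else 1%N.
apply: (@leq_trans (\prod_(q <- primes n) (b q * q ^ logn q n))%N).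
  rewrite !big_seq; apply: leq_prod => q qn.
  have q_pr : prime q by move: qn; rewrite mem_primes => /andP[].
  rewrite /b; case: ltnP => qk.
    apply: leq_trans (@expn_succ_le k (logn q n) isT) _.
    by rewrite leq_pmul2l // leq_expn2r // prime_gt1.
  rewrite mul1n; apply: (@leq_trans ((2 ^ logn q n) ^ k)).
    by rewrite leq_exp2r // ltn_expl.
  by rewrite -expnM mulnC expnM leq_expn2r.
rewrite big_split /= prod_primes_logn // leq_pmul2r //.
rewrite /b -big_mkcond /= big_const_seq iter_muln_1 leq_pexp2l //.
rewrite -size_filter -[X in (_ <= X)%N](size_iota 0).
apply: uniq_leq_size; first by rewrite filter_uniq // primes_uniq.
by move=> q; rewrite mem_filter mem_iota /= => /andP[].
Qed.

(** An integer that is at most polynomial in H has H ^ o(1) divisors: apply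
    [divisor_bound] with the exponent k (e + 1), then extract (e + 1)-th roots. *)
Lemma divisor_bound_pow (k A e : nat) :
  exists2 C : nat, (0 < C)%N & forall n H, (0 < n)%N -> (0 < H)%N ->
    (n <= A * H ^ e)%N -> (size (divisors n) ^ k <= C * H)%N.
Proof.
have [C C0 bC] := divisor_bound (k * e.+1).
exists (C * A.+1)%N; first by rewrite muln_gt0 C0.
move=> n H n0 H0 nAH; rewrite -(leq_exp2r _ _ (ltn0Sn e)) -expnM.
apply: leq_trans (bC n n0) _.
apply: (@leq_trans (C * (A * H ^ e))%N); first by rewrite leq_mul2l nAH orbT.
rewrite mulnA !expnMn leq_mul ?leq_pexp2l // leq_mul //.
  by rewrite expnS leq_pmulr // expn_gt0 C0.
by rewrite expnS (leq_trans (leqnSn A)) // leq_pmulr // expn_gt0.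
Qed.

Lemma expn_omega_le (D n : nat) :
  (D ^ size (primes n) <= size (divisors n) ^ D)%N.
Proof.
rewrite size_divisors -iter_muln_1.
have -> : iter (size (primes n)) (muln D) 1%N = (\prod_(q <- primes n) D)%N.
  by rewrite big_const_seq count_predT.
rewrite (big_morph (fun m => (m ^ D)%N) (id1 := 1%N) (op1 := muln)) => [|x y|];
  rewrite ?expnMn ?exp1n //.
rewrite !big_seq; apply: leq_prod => q qn.
apply: leq_trans (ltnW (ltn_expl D (ltnSn 1))) _.
by rewrite leq_expn2r // ltnS logn_gt0.
Qed.

(** * Lagrange interpolation over the integers, archimedean and q-adic *)

(** The denominator attached to the node x i in the Lagrange formula. *)
Definition nodegap (R : idomainType) (n : nat) (x : 'I_n -> R) (i : 'I_n) : R :=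
  \prod_(j < n | j != i) (x i - x j).

Lemma size_node_poly (R : idomainType) (n : nat) (x : 'I_n -> R) (i : 'I_n) :
  size (\prod_(j < n | j != i) ('X - (x j)%:P)) = n.
Proof.
rewrite -big_filter size_prod_XsubC size_filter.
have -> : count (fun j => j != i) (index_enum 'I_n) = #|predC1 i|.
  by rewrite cardE /enum_mem size_filter; apply: eq_count.
by rewrite cardC1 card_ord prednK // (leq_trans _ (ltn_ord i)).
Qed.

(** Both sides have degree less than n and agree at the n nodes.  Multiplying the
    interpolation formula by all the node products keeps it valid in an
    integral domain, so that it can be read over the integers. *)
Lemma lagrange_cleared (R : idomainType) (n : nat) (x : 'I_n -> R)
    (F : {poly R}) : injective x -> (size F <= n)%N ->
  (\prod_i nodegap x i) *: F =
  \sum_i (F.[x i] * \prod_(l < n | l != i) nodegap x l)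
           *: \prod_(j < n | j != i) ('X - (x j)%:P).
Proof.
move=> xinj sF; apply/eqP; rewrite -subr_eq0; apply/eqP.
set P := _ - _.
apply: (@roots_geq_poly_eq0 _ P [seq x i | i <- enum 'I_n]); last first.
- rewrite size_map size_enum_ord /P.
  apply: leq_trans (size_polyD _ _) _; rewrite size_polyN geq_max.
  rewrite (leq_trans (size_scale_leq _ _)) //=.
  apply: leq_trans (size_sum _ _ _) _; apply/bigmax_leqP => i _.
  apply: leq_trans (size_scale_leq _ _) _.
  by rewrite size_node_poly.
- by rewrite map_inj_uniq // enum_uniq.
apply/allP => _ /mapP[i _ ->]; rewrite /P rootE !hornerE horner_sum.
rewrite [X in _ - X](bigD1 i) //= [X in _ - (_ + X)]big1 => [|l li].
  rewrite addr0 hornerE horner_prod.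
  rewrite [\prod_(_ < n | _) ('X - _).[_]](eq_bigr (fun j => x i - x j)).
    rewrite -/(nodegap x i) (bigD1 i) //=.
    by apply/eqP; ring.
  by move=> j _; rewrite !hornerE.
rewrite hornerE horner_prod [X in _ * X](bigD1 i) 1?eq_sym //=.
by rewrite hornerXsubC subrr mul0r mulr0.
Qed.

Lemma lagrange_lead_coef (R : idomainType) (D : nat) (x : 'I_D.+1 -> R)
    (F : {poly R}) : injective x -> (size F <= D.+1)%N ->
  (\prod_i nodegap x i) * F`_D =
  \sum_i F.[x i] * \prod_(l < D.+1 | l != i) nodegap x l.
Proof.
move=> xinj sF; have /(congr1 (fun P : {poly R} => P`_D)) := lagrange_cleared xinj sF.
rewrite coefZ coef_sum => ->; apply: eq_bigr => i _; rewrite coefZ.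
have := size_node_poly x i.
have /monicP : \prod_(j < D.+1 | j != i) ('X - (x j)%:P) \is monic.
  exact: monic_prod_XsubC.
by rewrite lead_coefE => cm sz; move: cm; rewrite sz => ->; rewrite mulr1.
Qed.

(** The leading coefficient of F, a nonzero integer, is the sum over the nodes of
    F(x_i) / nodegap x i, and each of the D + 1 terms is at most
    B / delta ^ D. *)
Lemma lead_coef_spread (D : nat) (x : 'I_D.+1 -> int) (F : {poly int})
    (delta B : int) :
  0 < delta -> (forall i j, i != j -> delta <= `|x i - x j|) ->
  size F = D.+1 -> (forall i, `|F.[x i]| <= B) ->
  delta ^+ D <= D.+1%:R * B.
Proof.
move=> d0 dx sF FB.
have xinj : injective x.
  move=> i j xij; apply/eqP; apply: contraT => /dx.
  by rewrite xij subrr normr0 leNgt d0.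
have gap i : delta ^+ D <= `|nodegap x i|.
  rewrite /nodegap normr_prod.
  have -> : delta ^+ D = \prod_(j < D.+1 | j != i) delta.
    rewrite prodr_const; congr (_ ^+ _).
    by rewrite (eq_card (B := predC1 i)) // cardC1 card_ord.
  by apply: ler_prod => j ji; rewrite ltW //= dx // eq_sym.
have P0 : 0 < \prod_i `|nodegap x i|.
  by apply: prodr_gt0 => i _; apply: lt_le_trans (gap i); rewrite exprn_gt0.
have lF : 1 <= `|F`_D|.
  have : F`_D != 0 by rewrite -[D]/(D.+1.-1) -sF -lead_coefE
    lead_coef_eq0 -size_poly_eq0 sF.
  by rewrite -normr_gt0.
rewrite -(ler_pM2l P0); apply: le_trans (_ : `|\prod_i nodegap x i * F`_D| * delta ^+ D <= _).
  rewrite normrM normr_prod -mulrA ler_pM2l // ler_peMl // exprn_ge0 // ltW //.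
rewrite lagrange_lead_coef ?sF //.
apply: le_trans (_ : (\sum_i `|F.[x i]| * \prod_(l < D.+1 | l != i) `|nodegap x l|) * delta ^+ D
  <= _).
  rewrite ler_pM2r ?exprn_gt0 //; apply: le_trans (ler_norm_sum _ _ _) _.
  by apply: ler_sum => i _; rewrite normrM normr_prod.
rewrite mulr_suml; apply: le_trans (_ : \sum_(i < D.+1) \prod_l `|nodegap x l| * B <= _).
  apply: ler_sum => i _; rewrite [X in _ <= X * _](bigD1 i) //= [X in _ <= X]mulrC.
  rewrite -mulrA; apply: ler_pM => //.
    by rewrite mulr_ge0 ?prodr_ge0 // exprn_ge0 // ltW.
  by rewrite mulrC ler_wpM2r ?prodr_ge0.
by rewrite sumr_const card_ord -mulrnAr mulr_natl lexx.
Qed.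

Lemma absz_prod (I : finType) (P : pred I) (E : I -> int) :
  absz (\prod_(i | P i) E i) = (\prod_(i | P i) absz (E i))%N.
Proof. exact: (big_morph _ abszM). Qed.

Lemma logn_prod_pos (q : nat) (I : finType) (P : pred I) (E : I -> nat) :
  (forall i, P i -> 0 < E i)%N ->
  (logn q (\prod_(i | P i) E i) = \sum_(i | P i) logn q (E i))%N /\
  (0 < \prod_(i | P i) E i)%N.
Proof.
move=> E0; elim/big_rec2: _ => [|i y1 y2 Pi [<- y20]]; first by rewrite logn1.
by rewrite lognM ?muln_gt0 ?E0.
Qed.

(** If all the node products had q-adic valuation less than e, then in the
    Lagrange formula every F(x_i) / nodegap x i would be divisible by q, and so
    would all the coefficients of F. *)
Lemma padic_gap (q e n m : nat) (x : 'I_n -> int) (F : {poly int}) :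
  prime q -> injective x -> (size F <= n)%N ->
  (forall i, q ^ e %| absz (F.[x i])%R)%N -> ~~ (q %| absz (F`_m)%R)%N ->
  exists i, (e <= logn q (absz (nodegap x i)))%N.
Proof.
move=> q_pr xinj sF qF qm; apply/existsP; apply: contraT.
rewrite negb_exists => /forallP small.
have gap0 i : (0 < absz (nodegap x i))%N.
  rewrite absz_gt0; apply/prodf_neq0 => j ji.
  by rewrite subr_eq0 (inj_eq xinj) eq_sym.
pose v i := logn q (absz (nodegap x i)).
pose s := (\sum_i v i)%N.
have dvdP : (q ^ s.+1 %| absz ((\prod_i nodegap x i) * F`_m)%R)%N.
  have := congr1 (fun P : {poly int} => P`_m) (lagrange_cleared xinj sF).
  rewrite coefZ coef_sum => ->.
  suff : (Posz (q ^ s.+1) %| (\sum_(i < n) ((F.[x i] * \prod_(l < n | l != i) nodegap x l) *: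
             \prod_(j < n | j != i) ('X - (x j)%:P))`_m))%Z by [].
  apply: rpred_sum => i _; rewrite coefZ; apply: dvdz_mulr.
  rewrite dvdzE abszM absz_nat absz_prod.
  have [lp p0] := @logn_prod_pos q _ (fun l => l != i) (fun l => absz (nodegap x l))
    (fun l _ => gap0 l).
  have -> : s.+1 = (\sum_(l < n | l != i) v l + (v i).+1)%N.
    by rewrite /s (bigD1 i) //= addnC addnS.
  rewrite expnD mulnC dvdn_mul //; last by rewrite pfactor_dvdn // lp.
  apply: dvdn_trans (qF i); apply: dvdn_exp2l.
  by rewrite ltnNge small.
move: dvdP qm; rewrite abszM absz_prod.
have [lp p0] := @logn_prod_pos q _ predT (fun l => absz (nodegap x l)) (fun l _ => gap0 l).
have [->|Fm0] := eqVneq F`_m 0; first by rewrite dvdn0.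
rewrite pfactor_dvdn ?muln_gt0 ?p0 ?absz_gt0 // lognM ?absz_gt0 // lp -/s.
rewrite -addn1 leq_add2l => lm; rewrite -[q in (q %| _)%N]expn1 pfactor_dvdn ?absz_gt0 //.
by rewrite lm.
Qed.

(** * Polynomials with many values divisible by a given integer *)

(** Some node product has valuation at least e > D k by [padic_gap], and it has D
    factors, so one factor has valuation greater than k. *)
Lemma padic_close_pair (q e k D m : nat) (x : 'I_D.+1 -> int) (F : {poly int}) :
  prime q -> injective x -> (size F <= D.+1)%N -> (D * k < e)%N ->
  (forall i, q ^ e %| absz (F.[x i])%R)%N -> ~~ (q %| absz (F`_m)%R)%N ->
  exists i j, i != j /\ (q ^ k.+1 %| absz (x i - x j)%R)%N.
Proof.
move=> q_pr xinj sF Dke qF qm.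
have [i] := padic_gap q_pr xinj sF qF qm.
rewrite /nodegap absz_prod.
have nz j : j != i -> (0 < absz (x i - x j))%N.
  by move=> ji; rewrite absz_gt0 subr_eq0 (inj_eq xinj) eq_sym.
have [-> _] := @logn_prod_pos q _ (fun j => j != i) (fun j => absz (x i - x j)) nz.
move=> e_le; have [/existsP[j /andP[ji kj]]|] :=
  boolP [exists j, (j != i) && (k < logn q (absz (x i - x j)))%N].
  by exists i, j; split; rewrite 1?eq_sym // pfactor_dvdn // nz.
rewrite negb_exists => /forallP small; move: Dke; rewrite ltnNge => /negP[].
apply: leq_trans e_le _; apply: (@leq_trans (\sum_(j < D.+1 | j != i) k)%N).
  by apply: leq_sum => j ji; have := small j; rewrite ji /= -leqNgt.
by rewrite sum_nat_const (eq_card (B := predC1 i)) // cardC1 card_ord.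
Qed.

Lemma distinct_keys (T K : eqType) (key : T -> K) (D : nat) (S : seq T) :
  (D < size (undup (map key S)))%N ->
  exists x : 'I_D.+1 -> T, (forall i, x i \in S) /\ injective (key \o x).
Proof.
move=> szK; have [x0 _] : exists x0, x0 \in S.
  by case: S szK => // a S _; exists a; rewrite mem_head.
set ks := undup _ in szK.
pose x (i : 'I_D.+1) := nth x0 S (index (nth (key x0) ks i) (map key S)).
have ix (i : 'I_D.+1) : (index (nth (key x0) ks i) (map key S) < size S)%N.
  rewrite -(size_map key) index_mem -mem_undup mem_nth //.
  by apply: leq_ltn_trans szK; rewrite -ltnS.
have kx (i : 'I_D.+1) : key (x i) = nth (key x0) ks i.
  rewrite /x -(nth_map _ (key x0)) // nth_index // -mem_undup mem_nth //.
  by apply: leq_ltn_trans szK; rewrite -ltnS.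
exists x; split=> [i|i j /=]; first exact: mem_nth.
rewrite !kx => /eqP; rewrite nth_uniq ?undup_uniq // => [/eqP/val_inj //| |];
by apply: leq_ltn_trans szK; rewrite -ltnS.
Qed.

Lemma popular_key (T K : eqType) (key : T -> K) (D : nat) (S : seq T) :
  (size (undup (map key S)) <= D)%N ->
  exists S', [/\ subseq S' S, (size S <= D * size S')%N
    & {in S' &, forall x y, key x = key y}].
Proof.
move=> szK.
suff [S' [sub sz keyS]] : exists S', [/\ subseq S' S,
    (size S <= size (undup (map key S)) * size S')%N
    & {in S' &, forall x y, key x = key y}].
  by exists S'; split=> //; rewrite (leq_trans sz) // leq_mul2r szK orbT.
have : {in S, forall x, key x \in undup (map key S)}.
  by move=> x xS; rewrite mem_undup map_f.
move: (undup (map key S)) => ks; elim: ks S {szK} => [|k ks IH] S inS.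
  by case: S inS => [|a T0] inS; [exists [::] | have := inS a (mem_head _ _)].
have [|S2 [sub sz keyS]] := IH [seq x <- S | key x != k].
  by move=> x; rewrite mem_filter => /andP[xk /inS]; rewrite inE (negPf xk).
have szS := count_predC (fun x => key x == k) S.
rewrite -!size_filter in szS.
have [le12|/ltnW le21] := leqP (size [seq x <- S | key x == k]) (size S2).
  exists S2; split=> //; last by rewrite -szS [size (_ :: _)]/= mulSn leq_add.
  exact: subseq_trans sub (filter_subseq _ _).
exists [seq x <- S | key x == k]; split; first exact: filter_subseq.
  rewrite -[leqLHS]szS [size (_ :: _)]/= mulSn leq_add2l (leq_trans sz) //.
  by rewrite leq_mul2l le21 orbT.
by move=> x y; rewrite !mem_filter => /andP[/eqP-> _] /andP[/eqP-> _].
Qed.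

(** For a prime q dividing c exactly to the power e, the points take at most D
    residues modulo q ^ k with k the least integer not below e / D: among D + 1
    points with distinct residues, [padic_close_pair] would find two that agree.
    Keeping the most popular residue for each prime in turn loses a factor D per
    prime, and the product m of the moduli satisfies c <= m ^ D. *)
Lemma root_class (D c : nat) (F : {poly int}) (S : seq int) :
  (0 < D)%N -> (0 < c)%N -> (size F <= D.+1)%N ->
  (forall q, prime q -> (q %| c)%N -> exists m, ~~ (q %| absz (F`_m)%R)%N) ->
  (forall x, x \in S -> (c %| absz (F.[x])%R)%N) ->
  exists S' m, [/\ subseq S' S, (size S <= D ^ size (primes c) * size S')%N,
    (c <= m ^ D)%N & {in S' &, forall x y, (m %| absz (x - y)%R)%N}].
Proof.
(* The modulus attached to q is q ^ (k q).+1, where (k q).+1 is the least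
   integer that is not below (logn q c) / D. *)
move=> D0 c0 sF prim cF; pose k q := ((logn q c).-1 %/ D)%N.
have main ps : uniq ps -> {subset ps <= primes c} ->
    exists S', [/\ subseq S' S, (size S <= D ^ size ps * size S')%N
      & {in S' &, forall x y, (\prod_(q <- ps) q ^ (k q).+1 %| absz (x - y)%R)%N}].
  elim: ps => [|q ps IH] /=.
    by exists S; rewrite mul1n; split=> // x y _ _; rewrite big_nil.
  move=> /andP[qps ups] sub.
  have [S1 [subS1 sz1 dv1]] := IH ups (fun x xps => sub x (@mem_behead _ (q :: ps) x xps)).
  have : q \in primes c by rewrite sub ?mem_head.
  rewrite mem_primes => /and3P[q_pr _ qc].
  have [m qm] := prim q q_pr qc.
  have few : (size (undup (map (fun x => (x %% (q ^ (k q).+1)%N)%Z) S1)) <= D)%N.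
    rewrite leqNgt; apply/negP => /distinct_keys[x [xS1 xinj]].
    have xinj' : injective x by move=> i j xij; apply: xinj; rewrite /= xij.
    have Dke : (D * k q < logn q c)%N.
      rewrite mulnC (leq_ltn_trans (leq_divM _ _)) // ltn_predL logn_gt0.
      by rewrite mem_primes q_pr c0.
    have [i|i [j [ij qij]]] := padic_close_pair q_pr xinj' sF Dke _ qm.
      apply: dvdn_trans (pfactor_dvdnn _ _) _.
      by apply: cF; apply: (mem_subseq subS1).
    move/eqP: ij; apply; apply: xinj => /=; apply/eqP.
    by rewrite eqz_mod_dvd dvdzE absz_nat.
  have [S' [subS' sz' keyS']] := popular_key few.
  exists S'; split; first exact: subseq_trans subS' subS1.
    by rewrite expnSr -mulnA (leq_trans sz1) // leq_mul2l sz' orbT.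
  move=> x y xS' yS'; rewrite big_cons Gauss_dvd.
    apply/andP; split; last by apply: dv1; apply: (mem_subseq subS').
    have /eqP := keyS' x y xS' yS'.
    by rewrite eqz_mod_dvd dvdzE absz_nat.
  apply: coprimeXl; rewrite big_seq; elim/big_ind: _ => [|a b|r rps].
  - exact: coprimen1.
  - by rewrite coprimeMr => -> ->.
  apply: coprimeXr; rewrite prime_coprime // dvdn_prime2 //.
    by apply: contraNneq qps => ->.
  have : r \in primes c by rewrite sub // inE rps orbT.
  by rewrite mem_primes => /andP[].
have [S' [sub sz dv]] := main (primes c) (primes_uniq c) (fun x xs => xs).
exists S', (\prod_(q <- primes c) q ^ (k q).+1)%N; split=> //.
rewrite -[leqLHS]prod_primes_logn //.
rewrite (big_morph (fun m => (m ^ D)%N) (id1 := 1%N) (op1 := muln)) => [|x y|];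
  rewrite ?expnMn ?exp1n //.
rewrite !big_seq; apply: leq_prod => q; rewrite mem_primes => /and3P[q_pr _ qc].
rewrite -expnM leq_pexp2l ?prime_gt0 //.
have : (0 < logn q c)%N by rewrite logn_gt0 mem_primes q_pr c0.
by move=> e0; rewrite -[leqLHS]prednK // ltn_ceil.
Qed.

(** Consecutive elements of S in increasing order differ by at least m, so taking
    every t-th of them gives points m * t apart. *)
Lemma spaced_points (D t m : nat) (S : seq int) :
  (0 < m)%N -> uniq S -> {in S &, forall x y, (m %| absz (x - y)%R)%N} ->
  (D * t < size S)%N ->
  exists x : 'I_D.+1 -> int, (forall i, x i \in S) /\
    forall i j, i != j -> (m * t)%:Z <= `|x i - x j|.
Proof.
move=> m0 uS dv DtS; pose ys := sort <=%O S.
have sz_ys : size ys = size S by rewrite size_sort.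
have in_S l : (l < size ys)%N -> ys`_l \in S.
  by move=> ll; rewrite -(mem_sort <=%O) mem_nth.
have step l : (l.+1 < size ys)%N -> m%:Z <= ys`_l.+1 - ys`_l.
  move=> ll; have lt_ys : ys`_l < ys`_l.+1.
    have : sorted <%O ys by rewrite lt_sorted_uniq_le sort_uniq uS sort_le_sorted.
    by move/(sortedP 0); apply.
  have := dv _ _ (in_S _ ll) (in_S _ (ltnW ll)) => /dvdn_leq.
  rewrite absz_gt0 subr_eq0 gt_eqF // => /(_ isT).
  by rewrite -lez_nat gez0_abs // subr_ge0 ltW.
have far n l : (l + n < size ys)%N -> (m * n)%:Z <= ys`_(l + n) - ys`_l.
  elim: n => [|n IHn] ln; first by rewrite addn0 subrr muln0.
  rewrite addnS in ln *; have := lerD (step _ ln) (IHn (ltnW ln)).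
  by rewrite addrA subrK mulnS PoszD.
have bnd (i : 'I_D.+1) : (i * t < size ys)%N.
  by rewrite sz_ys (leq_ltn_trans _ DtS) // leq_mul2r -ltnS ltn_ord orbT.
have key (i j : 'I_D.+1) : (i < j)%N -> (m * t)%:Z <= `|ys`_(j * t) - ys`_(i * t)|.
  move=> ij; apply: le_trans (ler_norm _).
  have jE : (j * t = i * t + (j - i) * t)%N by rewrite -mulnDl subnKC // ltnW.
  have := bnd j; rewrite jE => /far; apply: le_trans.
  by rewrite lez_nat leq_mul2l leq_pmull ?orbT // subn_gt0.
exists (fun i => ys`_(i * t)); split=> [i|i j].
  exact: in_S.
case: (ltngtP i j) => [ij _|ji _|/val_inj->]; last by rewrite eqxx.
  by rewrite distrC key.
exact: key.
Qed.

(** After [root_class] the surviving points are m apart with c <= m ^ D.  When they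
    are more than D t in number, D + 1 of them are m t apart, and [lead_coef_spread]
    with delta = m t and B = c H gives t ^ D <= (D + 1) H. *)
Lemma poly_multiple_bound (D c H : nat) (F : {poly int}) (S : seq int) :
  (0 < D)%N -> (0 < c)%N -> (0 < H)%N -> size F = D.+1 ->
  (forall q, prime q -> (q %| c)%N -> exists m, ~~ (q %| absz (F`_m)%R)%N) ->
  uniq S -> (forall x, x \in S -> (c %| absz (F.[x])%R)%N /\ (absz (F.[x])%R <= c * H)%N) ->
  exists M, (size S <= D ^ size (primes c) * M)%N /\
            (M ^ D <= (2 * D) ^ D * (D.+1 * H))%N.
Proof.
move=> D0 c0 H0 sF prim uS FS.
have [|S' [m [sub sz cm dv]]] := root_class D0 c0 (eq_leq sF) prim (S := S).
  by move=> x /FS[].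
exists (size S'); split=> //.
have D2 : (0 < (2 * D) ^ D)%N by rewrite expn_gt0 muln_gt0 D0.
have DH : (0 < D.+1 * H)%N by rewrite muln_gt0.
(* The largest t for which S' has more than D t elements. *)
pose t := ((size S').-1 %/ D)%N.
have szt : (size S' <= D * t.+1)%N.
  have := ltn_ceil (size S').-1 D0; rewrite -/t mulnC.
  by case: (size S').
have [t0|tp] := posnP t.
  rewrite t0 muln1 in szt; apply: leq_trans (leq_pmulr _ DH).
  by rewrite leq_expn2r // (leq_trans szt) // leq_pmull.
have mp : (0 < m)%N by case: m cm {dv} => //; rewrite exp0n // leqNgt c0.
have S'0 : (0 < size S')%N by case: (size S') @t szt tp => //=; rewrite div0n.
have DtS : (D * t < size S')%N.
  by rewrite mulnC -[ltnRHS]prednK // ltnS leq_divM.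
have [x [xS far]] := spaced_points mp (subseq_uniq sub uS) dv DtS.
have mt0 : 0 < (m * t)%:Z by rewrite ltz_nat muln_gt0 mp.
have := lead_coef_spread (B := (c * H)%:Z) mt0 far sF.
have FB i : `|F.[x i]| <= (c * H)%:Z.
  by rewrite -abszE lez_nat; have [] := FS _ (mem_subseq sub (xS i)).
move=> /(_ FB); rewrite -!natz -natrX -natrM ler_nat => bnd.
have tD : (t ^ D <= D.+1 * H)%N.
  have mD : (0 < m ^ D)%N by rewrite expn_gt0 mp.
  rewrite -(leq_pmul2l mD) -expnMn (leq_trans bnd) //.
  by rewrite mulnCA leq_mul2r cm orbT.
apply: (@leq_trans ((2 * D * t) ^ D)); last by rewrite expnMn leq_mul2l tD orbT.
rewrite leq_expn2r // (leq_trans szt) // mulnC -mulnA mulnCA mulnC leq_mul2l.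
by rewrite mul2n -addnn -addn1 leq_add2l tp orbT.
Qed.

(** Dividing c and F by the gcd of c and the content of F makes F primitive at
    every prime divisor of the new c, as [poly_multiple_bound] requires. *)
Lemma graph_poly_bound (D H : nat) (c : int) (F : {poly int}) (S : seq int) :
  (0 < D)%N -> c != 0 -> (0 < H)%N -> size F = D.+1 -> uniq S ->
  (forall x, x \in S -> exists2 y, (absz y <= H)%N & c * y = F.[x]) ->
  exists c' M, [/\ (0 < c' <= absz c)%N, (size S <= D ^ size (primes c') * M)%N
    & (M ^ D <= (2 * D) ^ D * (D.+1 * H))%N].
Proof.
move=> D0 c0 H0 sF uS FS.
pose g := gcdz c (zcontents F).
have g0 : g != 0 by rewrite gcdz_eq0 negb_and c0.
have cE : c = (c %/ g)%Z * g by rewrite divzK // dvdz_gcdl.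
have zE : zcontents F = (zcontents F %/ g)%Z * g by rewrite divzK // dvdz_gcdr.
set c1 := (c %/ g)%Z in cE; set z1 := (zcontents F %/ g)%Z in zE.
pose F1 := z1 *: zprimitive F.
have FE : F = g *: F1 by rewrite scalerA mulrC -zE -zpolyEprim.
have F0 : F != 0 by rewrite -size_poly_eq0 sF.
have c10 : c1 != 0 by apply: contraNneq c0 => c10; rewrite cE c10 mul0r.
have zF1 : zcontents F1 = z1 by rewrite zcontentsZ zcontents_primitive F0 mulr1.
(* No prime divides both c1 and the content of F1. *)
have cg : coprimez c1 z1.
  rewrite /coprimez; have : gcdz (c1 * g) (z1 * g) = gcdz c1 z1 * `|g|%N by rewrite mulz_gcdl.
  rewrite -cE -zE -/g => gE; apply/eqP; apply: (mulIf g0); rewrite mul1r.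
  have absg : (absz g)%:Z = g by rewrite /g /gcdz absz_nat.
  by rewrite absg in gE; exact: esym gE.
have c1p : (0 < absz c1)%N by rewrite absz_gt0.
have [|q q_pr qc||x xS|M [szS MD]] := @poly_multiple_bound D (absz c1) H F1 S D0 c1p H0.
- by rewrite -sF [in RHS]FE (size_scale F1 g0).
- apply/not_existsP => all_q.
  have : (q%:Z %| zcontents F1)%Z.
    rewrite dvdz_contents; apply/polyOverP => m; rewrite dvdzE absz_nat.
    by have /negP := all_q m; rewrite negbK.
  rewrite zF1 dvdzE absz_nat => qz.
  have : (q %| gcdn (absz c1) (absz z1))%N by rewrite dvdn_gcd qc.
  by move/eqP: cg => [->]; rewrite dvdn1 => /eqP q1; rewrite q1 in q_pr.
- by [].
- have [y yH cy] := FS x xS.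
  have -> : F1.[x] = c1 * y.
    have gF : g * F1.[x] = F.[x] by rewrite -hornerZ -FE.
    by apply: (mulfI g0); rewrite gF -cy cE; ring.
  by rewrite abszM dvdn_mulr //= leq_mul2l yH orbT.
exists (absz c1), M; rewrite c1p /=; split=> //.
by rewrite [in leqRHS]cE abszM leq_pmulr // absz_gt0.
Qed.

(** * Fractions in lowest terms *)

(** The last clause says that one of a and b has degree exactly D: together with
    coprimality, the fraction a / b then has degree D. *)
Definition lowest_terms (K : fieldType) (D : nat) (a b : {poly K}) : Prop :=
  [/\ (size a <= D.+1)%N, (size b <= D.+1)%N, coprimep a b
    & (a`_D != 0) || (b`_D != 0)].

Lemma lowest_terms_sym (K : fieldType) (D : nat) (a b : {poly K}) :
  lowest_terms D a b -> lowest_terms D b a.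
Proof. by case=> sa sb cab ab; split; rewrite 1?coprimep_sym 1?orbC. Qed.

Lemma size_eq_coef (R : nzRingType) (D : nat) (a : {poly R}) :
  (size a <= D.+1)%N -> a`_D != 0 -> size a = D.+1.
Proof.
move=> sa aD; apply/eqP; rewrite eqn_leq sa ltnNge /=.
by apply: contra aD => ?; rewrite nth_default.
Qed.

(** If a has degree D, then a divides a' by coprimality, and a' has no larger
    degree; if b has degree D, exchange the two. *)
Lemma proportional_pair (K : fieldType) (D : nat) (a b a' b' : {poly K}) :
  lowest_terms D a b -> (size a' <= D.+1)%N -> (size b' <= D.+1)%N ->
  a * b' = a' * b -> exists c, a' = c *: a /\ b' = c *: b.
Proof.
wlog aD : a b a' b' / a`_D != 0 => [hw lt sa' sb' E|[sa _ cab _] sa' _ E].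
  have [_ _ _ /orP[aD|bD]] := lt; first exact: hw.
  have E' : b * a' = b' * a by rewrite mulrC -E mulrC.
  have [c [b'E a'E]] := hw b a b' a' bD (lowest_terms_sym lt) sb' sa' E'.
  by exists c.
have sza := size_eq_coef sa aD.
have a0 : a != 0 by rewrite -size_poly_eq0 sza.
have [a'0|a'n0] := eqVneq a' 0.
  exists 0; rewrite !scale0r a'0; split=> //; apply/eqP.
  by move/eqP: E; rewrite a'0 mul0r mulf_eq0 (negPf a0).
have aa' : a %| a' by rewrite -(Gauss_dvdpl _ cab) -E dvdp_mulr.
have /eqpf_eq[c c0 a'E] : a' %= a.
  by rewrite eqp_sym -dvdp_size_eqp // eqn_leq dvdp_leq //= sza.
exists c; split=> //; apply: (mulfI a0); rewrite E a'E.
by rewrite -scalerAl scalerAr.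
Qed.

(** The polynomial a b' - a' b has degree at most 2 D and vanishes at more
    than 2 D points, so it is zero. *)
Lemma pair_unique_on_points (K : fieldType) (D : nat) (a b a' b' : {poly K})
    (s : seq K) :
  lowest_terms D a b -> (size a' <= D.+1)%N -> (size b' <= D.+1)%N ->
  uniq s -> (D.*2 < size s)%N ->
  (forall x, x \in s -> exists y, a.[x] + y * b.[x] = 0 /\ a'.[x] + y * b'.[x] = 0) ->
  exists c, a' = c *: a /\ b' = c *: b.
Proof.
move=> lt sa' sb' us ss rel; have [sa sb _ _] := lt.
apply: proportional_pair lt _ _ _ => //.
apply/eqP; rewrite -subr_eq0; apply/eqP.
have szM (u v : {poly K}) : (size u <= D.+1)%N -> (size v <= D.+1)%N ->
    (size (u * v)%R <= (D.*2).+1)%N.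
  move=> su sv; apply: leq_trans (size_polyMleq _ _) _.
  by have := leq_add su sv; rewrite addSn addnS addnn; case: (_ + _)%N.
apply: roots_geq_poly_eq0 us _; last first.
  apply: leq_trans ss; apply: leq_trans (size_polyD _ _) _.
  by rewrite size_polyN geq_max !szM.
apply/allP => x /rel[y [E E']]; rewrite rootE !hornerE.
have -> : a.[x] = - (y * b.[x]) by apply/eqP; rewrite -addr_eq0 E.
have -> : a'.[x] = - (y * b'.[x]) by apply/eqP; rewrite -addr_eq0 E'.
by apply/eqP; ring.
Qed.

(** * Lifting a graph from a finite field to the integers *)

Lemma det_bound (R : numDomainType) (n : nat) (A : 'M[R]_n) (b : 'I_n -> R) :
  (forall i j, `|A i j| <= b j) -> `|\det A| <= n`!%:R * \prod_j b j.
Proof.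
move=> Ab; apply: le_trans (ler_norm_sum _ _ _) _.
rewrite -(perm.card_Sn n) mulr_natl -sumr_const; apply: ler_sum => s _.
rewrite normrMsign normr_prod [leRHS](reindex_inj (@perm.perm_inj _ s)) /=.
apply: ler_prod => i _; rewrite normr_ge0 /=; exact: Ab.
Qed.

(** The cofactors of the top row do not depend on it, so they may be computed with
    that row replaced by 0. *)
Lemma det_top_row (R : comNzRingType) (n : nat) (z : 'rV[R]_n.+1)
    (W : 'M[R]_(n, n.+1)) :
  \det (col_mx z W : 'M[R]_(1 + n)) =
  \sum_j z 0 j * cofactor (col_mx 0 W : 'M[R]_(1 + n)) ord0 j.
Proof.
rewrite (expand_det_row _ (lshift n ord0)); apply: eq_bigr => j _.
rewrite col_mxEu; congr (_ * _); rewrite /cofactor; congr (_ * \det _).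
apply/matrixP=> i k; rewrite !mxE.
have -> : lift (lshift n ord0) i = rshift 1 i by apply: val_inj.
have -> : lift ord0 i = rshift 1 i by apply: val_inj.
by rewrite (unsplitK (inr i)).
Qed.

(** A row vector w of this length encodes the pair (A, B) of polynomials of degree
    at most D whose coefficients are its two halves; its product with
    [monomial_row D x y] is then A(x) + y B(x). *)
Definition monomial_row (R : nzRingType) (D : nat) (x y : R) : 'rV[R]_(D.+1 + D.+1) :=
  row_mx (\row_i x ^+ i) (\row_i (y * x ^+ i)).

Lemma horner_monomial_row (R : comNzRingType) (D : nat) (x y : R) (w : 'rV[R]_(D.+1 + D.+1)) :
  \sum_j monomial_row D x y 0 j * w 0 j =
  (rVpoly (lsubmx w)).[x] + y * (rVpoly (rsubmx w)).[x].
Proof.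
rewrite big_split_ord /= !(@horner_coef_wide _ D.+1) ?size_poly // mulr_sumr.
congr (_ + _); apply: eq_bigr => i _; rewrite coef_rVpoly_ord.
  by rewrite row_mxEl !mxE mulrC.
by rewrite row_mxEr !mxE -mulrA [w _ _ * _]mulrC.
Qed.

Lemma map_monomial_row (R S : nzRingType) (f : {rmorphism R -> S}) (D : nat) (x y : R) :
  map_mx f (monomial_row D x y) = monomial_row D (f x) (f y).
Proof.
rewrite /monomial_row map_row_mx; congr row_mx; apply/rowP=> i;
by rewrite !mxE ?rmorphM rmorphXn.
Qed.

Definition monomial_bound (D : nat) (H : int) (j : 'I_(D.+1 + D.+1)) : int :=
  match fintype.split j with inl i => H ^+ i | inr i => H ^+ i.+1 end.

Lemma norm_monomial_row_le (D : nat) (x y H : int) (j : 'I_(D.+1 + D.+1)) :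
  `|x| <= H -> `|y| <= H -> `|monomial_row D x y 0 j| <= monomial_bound H j.
Proof.
move=> xH yH; rewrite /monomial_bound mxE; have H0 := le_trans (normr_ge0 x) xH.
have xi i : `|x ^+ i| <= H ^+ i by rewrite normrX lerXn2r ?nnegrE.
case: fintype.split => i; rewrite mxE //.
by rewrite normrM exprS ler_pM.
Qed.

Lemma monomial_bound_le (D : nat) (H : int) (j : 'I_(D.+1 + D.+1)) :
  1 <= H -> monomial_bound H j <= H ^+ D.+1.
Proof.
move=> H1; rewrite /monomial_bound; case: fintype.split => i; rewrite ler_weXn2l //.
by rewrite ltnW.
Qed.

(** The exponents add up to the sum of 2 i + 1 over i <= D, which is
    (D + 1) ^ 2. *)
Lemma prod_monomial_bound (D : nat) (H : int) :
  \prod_j monomial_bound (D := D) H j = H ^+ (D.+1 ^ 2).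
Proof.
rewrite big_split_ord /= /monomial_bound.
under eq_bigr => i _ do rewrite (unsplitK (inl i)).
under [X in _ * X]eq_bigr => i _ do rewrite (unsplitK (inr i)).
elim: D.+1 => [|m IHm]; first by rewrite !big_ord0 mulr1.
rewrite !big_ord_recr /= mulrACA IHm -!exprD; congr (_ ^+ _); lia.
Qed.

Lemma det_relation_eq0 (R : idomainType) (m : nat) (M : 'M[R]_m) (u : 'I_m -> R) :
  (exists j, u j != 0) -> (forall i, \sum_j M i j * u j = 0) -> \det M = 0.
Proof.
move=> [j0 uj0] Mu; rewrite -det_tr; apply/eqP/det0P; exists (\row_j u j).
  by apply: contraNneq uj0 => /rowP/(_ j0); rewrite !mxE => ->.
apply/rowP=> i; rewrite !mxE -[RHS](Mu i); apply: eq_bigr => j _.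
by rewrite !mxE mulrC.
Qed.

Section LiftRelation.

Variables (K : fieldType) (p : nat) (D H : nat) (a b : {poly K}).
Variables (xys : seq (int * int)).
Hypothesis pK : p \in [pchar K].
Hypothesis H0 : (0 < H)%N.
Hypothesis lt : lowest_terms D a b.
Hypothesis sz : (D.*2 < size xys)%N.
Hypothesis uniqK : uniq [seq z.1%:~R : K | z <- xys].
Hypothesis box : forall z, z \in xys -> `|z.1| <= H%:Z /\ `|z.2| <= H%:Z.
Hypothesis rel : forall z, z \in xys ->
  a.[z.1%:~R] + z.2%:~R * b.[z.1%:~R] = 0.
Hypothesis Hp : ((D.+1 + D.+1)`! * H ^ (D.+1 ^ 2) < p)%N.

Let n := (D + D.+1)%N.
Let pt (i : nat) : int * int := nth (0, 0) xys i.
Let W : 'M[int]_(n, n.+1) :=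
  \matrix_(i, j) monomial_row D (pt i).1 (pt i).2 0 j.
Let w : 'rV[int]_(D.+1 + D.+1) :=
  \row_j cofactor (col_mx (0 : 'rV_n.+1) W : 'M[int]_(1 + n)) ord0 j.

Let pt_in (i : 'I_n) : pt i \in xys.
Proof.
rewrite mem_nth // (leq_trans (ltn_ord i)) // (leq_trans _ sz) //.
by rewrite /n addnS addnn.
Qed.

Let kap : 'rV[K]_(D.+1 + D.+1) := row_mx (poly_rV a) (poly_rV b).

Let lkap : rVpoly (lsubmx kap) = a.
Proof. by rewrite row_mxKl poly_rV_K //; case: lt. Qed.

Let rkap : rVpoly (rsubmx kap) = b.
Proof. by rewrite row_mxKr poly_rV_K //; case: lt. Qed.

Let kap_nz : exists j, kap 0 j != 0.
Proof.
case: lt => _ _ _ /orP[] ?.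
  by exists (lshift _ ord_max); rewrite row_mxEl mxE.
by exists (rshift _ ord_max); rewrite row_mxEr mxE.
Qed.

Let row_eq (M N : 'rV[K]_(D.+1 + D.+1)) (c : K) :
  rVpoly (lsubmx M) = c *: rVpoly (lsubmx N) ->
  rVpoly (rsubmx M) = c *: rVpoly (rsubmx N) -> M = c *: N.
Proof.
rewrite -[M]hsubmxK -[N]hsubmxK !row_mxKl !row_mxKr scale_row_mx.
by rewrite -!linearZ => /(can_inj rVpolyK) <- /(can_inj rVpolyK) <-.
Qed.

Let unique_row (v : 'rV[K]_(D.+1 + D.+1)) :
  (forall i : 'I_n, \sum_j monomial_row D (pt i).1%:~R (pt i).2%:~R 0 j * v 0 j = 0) ->
  exists c, v = c *: kap.
Proof.
move=> vW; pose s := [seq z.1%:~R : K | z <- take n xys].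
have szs : size s = n.
  rewrite size_map size_takel // (leq_trans _ sz) // /n addnS addnn //.
have [||||x|c [e1 e2]] := @pair_unique_on_points K D a b
    (rVpoly (lsubmx v)) (rVpoly (rsubmx v)) s lt; rewrite ?size_poly //.
- by rewrite /s map_take take_uniq.
- by rewrite szs /n addnS addnn.
- move=> /(nthP 0)[i]; rewrite szs => lti <-.
  rewrite (nth_map (0, 0)) ?size_takel //; last first.
    by rewrite (leq_trans _ sz) // /n addnS addnn.
  rewrite nth_take //; exists (pt i).2%:~R; split.
    exact: rel (pt_in (Ordinal lti)).
  by rewrite -horner_monomial_row; exact: vW (Ordinal lti).
by exists c; apply: row_eq; rewrite ?lkap ?rkap.
Qed.

Let W_map (i : 'I_n) (j : 'I_n.+1) :
  (W i j)%:~R = monomial_row D ((pt i).1%:~R : K) (pt i).2%:~R 0 j.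
Proof. by rewrite -map_monomial_row !mxE. Qed.

Let top_det (z : 'rV[int]_n.+1) :
  \det (col_mx z W : 'M[int]_(1 + n)) = \sum_j z 0 j * w 0 j.
Proof. by rewrite det_top_row; apply: eq_bigr => j _; rewrite mxE. Qed.

Let kap_rel (z : int * int) : z \in xys ->
  \sum_j (monomial_row D z.1 z.2 0 j)%:~R * kap 0 j = 0 :> K.
Proof.
move=> /rel zr; rewrite -[RHS]zr -lkap -rkap -horner_monomial_row.
by apply: eq_bigr => j _; rewrite -map_monomial_row [in RHS]mxE.
Qed.

Let w_rel (z : int * int) : z \in xys ->
  \sum_j monomial_row D z.1 z.2 0 j * w 0 j = 0.
Proof.
move=> zin; rewrite -top_det; set M := col_mx _ _.
(* Modulo p, the coefficients of (a, b) give a column killed by the matrix. *)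
have Mp : (p%:Z %| \det (M : 'M[int]_(1 + n)))%Z.
  rewrite (dvdz_pcharf pK) -det_map_mx; apply/eqP.
  apply: (@det_relation_eq0 _ _ _ (fun j => kap 0 j)) => // i.
  rewrite -[RHS](_ : \sum_j (M i j)%:~R * kap 0 j = 0).
    by apply: eq_bigr => j _; rewrite mxE.
  rewrite /M -[i](@splitK 1 n); case: (@fintype.split 1 n i) => k /=.
    rewrite -[RHS](kap_rel zin); apply: eq_bigr => j _.
    by rewrite col_mxEu (ord1 k).
  rewrite -[RHS](kap_rel (pt_in k)); apply: eq_bigr => j _.
  by rewrite col_mxEd mxE.
have Ml : `|\det (M : 'M[int]_(1 + n))| < p%:Z.
  apply: le_lt_trans (_ : (((D.+1 + D.+1)`! * H ^ (D.+1 ^ 2))%N)%:Z < _); last first.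
    by rewrite ltz_nat.
  have -> : ((D.+1 + D.+1)`! * H ^ (D.+1 ^ 2))%N%:Z
            = ((D.+1 + D.+1)`!)%:R * H%:Z ^+ (D.+1 ^ 2).
    by rewrite -[H%:Z]natz -natrX -natrM natz.
  rewrite -prod_monomial_bound.
  apply: det_bound => i j; rewrite /M -[i](@splitK 1 n); case: (@fintype.split 1 n i) => k /=.
    by rewrite col_mxEu (ord1 k); have [? ?] := box zin; apply: norm_monomial_row_le.
  by rewrite col_mxEd mxE; have [? ?] := box (pt_in k); apply: norm_monomial_row_le.
apply/eqP; move: Mp Ml; rewrite dvdzE absz_nat -abszE ltz_nat -absz_eq0.
by case: (absz _) => // m /dvdn_leq le /(leq_ltn_trans (le isT)); rewrite ltnn.
Qed.

Let wK_nz : map_mx intr w != 0 :> 'rV[K]_(D.+1 + D.+1).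
Proof.
(* Complete the rows of the points by the unit row at an index j0 where
   the coefficient vector of (a, b) is nonzero: the result is invertible, and
   its determinant is the j0-th cofactor. *)
have [j0 kj0] := kap_nz; apply: contra kj0 => /eqP w0.
pose d : 'rV[int]_n.+1 := delta_mx 0 j0.
have detE : (\det (col_mx d W : 'M[int]_(1 + n)))%:~R = 0 :> K.
  rewrite top_det rmorph_sum big1 // => j _; rewrite rmorphM /=.
  by move/rowP/(_ j): w0; rewrite !mxE => ->; rewrite mulr0.
move/eqP: detE; rewrite -det_map_mx -det_tr => /det0P[v v0 vM].
have vE i : \sum_j (col_mx d W i j)%:~R * v 0 j = 0 :> K.
  move/rowP/(_ i): vM; rewrite !mxE => E; rewrite -[RHS]E.
  by apply: eq_bigr => j _; rewrite !mxE mulrC.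
have [i|c vc] := unique_row (v := v).
  rewrite -[RHS](vE (rshift 1 i)); apply: eq_bigr => j _.
  by rewrite col_mxEd W_map.
have := vE (lshift n ord0); rewrite (bigD1 j0) //= big1 => [|j jj0].
  rewrite addr0 col_mxEu mxE !eqxx mul1r vc mxE => /eqP.
  rewrite mulf_eq0 => /orP[/eqP c0|//].
  by rewrite vc c0 scale0r eqxx in v0.
by rewrite col_mxEu mxE (negPf jj0) andbF mul0r.
Qed.

Let w_bound j : `|w 0 j| <= (n`!)%:R * H%:R ^+ (D.+1 * n).
Proof.
rewrite mxE /cofactor normrMsign.
have := @det_bound _ _ (row' ord0 (col' j (col_mx (0 : 'rV_n.+1) W : 'M[int]_(1 + n))))
  (fun=> H%:R ^+ D.+1).
rewrite prodr_const card_ord -exprM => -> // i k; rewrite !mxE.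
have -> : lift ord0 i = rshift 1 i by apply: val_inj.
rewrite (unsplitK (inr i)) mxE.
have [x1 y1] := box (pt_in i); apply: le_trans (norm_monomial_row_le _ x1 y1) _.
by rewrite natz monomial_bound_le // lez_nat.
Qed.

(** At each point, the monomial row placed on top of W gives a determinant that is
    a multiple of p and smaller than p, hence zero; its expansion along that row is
    the relation, with the vector w of cofactors for coefficients.  As (a, b) is the
    only relation modulo p up to a factor, w reduces to a multiple of it. *)
Lemma lift_relation : exists A B : {poly int},
  [/\ (size A <= D.+1)%N /\ (size B <= D.+1)%N,
      forall i, `|A`_i| <= (n`!)%:R * H%:R ^+ (D.+1 * n) /\
                `|B`_i| <= (n`!)%:R * H%:R ^+ (D.+1 * n),
      forall z, z \in xys -> A.[z.1] + z.2 * B.[z.1] = 0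
    & exists c : K, [/\ c != 0, map_poly intr A = c *: a & map_poly intr B = c *: b]].
Proof.
exists (rVpoly (lsubmx w)), (rVpoly (rsubmx w)); split.
- by rewrite !size_poly.
- have bd (v : 'rV[int]_D.+1) i : (forall j, `|v 0 j| <= (n`!)%:R * H%:R ^+ (D.+1 * n)) ->
      `|(rVpoly v)`_i| <= (n`!)%:R * H%:R ^+ (D.+1 * n).
    move=> vb; rewrite coef_rVpoly; case: insubP => [j _ _|_]; first exact: vb.
    by rewrite normr0 mulr_ge0 // exprn_ge0.
  by move=> i; split; apply: bd => j; rewrite mxE w_bound.
- by move=> z zin; rewrite -horner_monomial_row w_rel.
have [i|c wc] := unique_row (v := map_mx intr w).
  rewrite -[RHS](_ : (\sum_j monomial_row D (pt i).1 (pt i).2 0 j * w 0 j)%:~R = 0); last first.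
    by rewrite w_rel.
  rewrite rmorph_sum; apply: eq_bigr => j _.
  by rewrite rmorphM -map_monomial_row !mxE.
exists c; split.
- by apply: contraNneq wK_nz => c0; rewrite wc c0 scale0r.
- by rewrite map_rVpoly map_lsubmx wc linearZ /= linearZ /= lkap.
- by rewrite map_rVpoly map_rsubmx wc linearZ /= linearZ /= rkap.
Qed.
End LiftRelation.

(** * Bezout relations from the Sylvester determinant *)

(** The Sylvester matrix of a and b taken as forms of degree D, whatever their
    actual degrees: this makes it commute with reduction modulo p. *)
Definition sylvester_form (R : nzRingType) (D : nat) (a b : {poly R}) : 'M[R]_(D + D) :=
  col_mx (\matrix_(i, j) ('X^i * a)`_j) (\matrix_(i, j) ('X^i * b)`_j).

Lemma sylvester_form_mul (R : comNzRingType) (D : nat) (a b : {poly R}) (v : 'rV[R]_(D + D)) :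
  v *m sylvester_form D a b = poly_rV (rVpoly (lsubmx v) * a + rVpoly (rsubmx v) * b).
Proof.
have half (u : 'rV[R]_D) (q : {poly R}) :
    u *m (\matrix_(i, j) ('X^i * q)`_j) = poly_rV (rVpoly u * q) :> 'rV_(D + D).
  apply/rowP=> j; rewrite !mxE /rVpoly poly_def mulr_suml coef_sum.
  apply: eq_bigr => i _; rewrite mxE valK -scalerAl coefZ.
  by [].
by rewrite -{1}[v]hsubmxK mul_row_col !half linearD.
Qed.

Lemma size_sylvester (R : idomainType) (D : nat) (a b u v : {poly R}) :
  (size a <= D.+1)%N -> (size b <= D.+1)%N -> (size u <= D)%N -> (size v <= D)%N ->
  (size (u * a + v * b)%R <= D + D)%N.
Proof.
move=> sa sb su sv; apply: leq_trans (size_polyD _ _) _; rewrite geq_max.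
have szM (f g : {poly R}) : (size f <= D)%N -> (size g <= D.+1)%N ->
    (size (f * g)%R <= D + D)%N.
  move=> sf sg; apply: leq_trans (size_polyMleq _ _) _.
  by have := leq_add sf sg; rewrite addnS; case: (_ + _)%N.
by rewrite !szM.
Qed.

(** A vector in the kernel gives U a + V b = 0 with U and V of degree less than D.
    By [proportional_pair], (- V, U) is then a multiple of (a, b), one of which has
    degree D, so the multiple is zero. *)
Lemma sylvester_form_det_neq0 (K : fieldType) (D : nat) (a b : {poly K}) :
  lowest_terms D a b -> \det (sylvester_form D a b) != 0.
Proof.
move=> lt; have [sa sb cab ab] := lt.
apply/negP => /det0P[v v0]; rewrite sylvester_form_mul.
set U := rVpoly _; set V := rVpoly _.
have [sU sV] : (size U <= D)%N /\ (size V <= D)%N by rewrite !size_poly.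
move/(congr1 rVpoly); rewrite poly_rV_K ?size_sylvester // linear0 => E.
have E' : a * U = - V * b.
  by apply/eqP; rewrite mulNr -addr_eq0 [a * U]mulrC E.
have [|||c [Vc Uc]] := @proportional_pair _ D a b (- V) U lt; rewrite ?size_polyN //.
- exact: leqW.
- exact: leqW.
have c0 : c = 0.
  have aD : c * a`_D = 0 by rewrite -coefZ -Vc nth_default // size_polyN.
  have bD : c * b`_D = 0 by rewrite -coefZ -Uc nth_default.
  case/orP: ab => n0; first by move/eqP: aD; rewrite mulf_eq0 (negPf n0) orbF => /eqP.
  by move/eqP: bD; rewrite mulf_eq0 (negPf n0) orbF => /eqP.
move: Vc Uc; rewrite c0 !scale0r => /eqP; rewrite oppr_eq0 => /eqP V0 U0.
case/negP: v0; rewrite -[v]hsubmxK -[lsubmx v]rVpolyK -[rsubmx v]rVpolyK.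
by rewrite -/U -/V U0 V0 !linear0 row_mx0.
Qed.

(** A row of the adjugate of the Sylvester matrix S provides U and V with
    U A + V B = det S.  The determinant is nonzero because its reduction modulo the
    characteristic is the Sylvester determinant of a pair in lowest terms. *)
Lemma bezout_det (D : nat) (A B : {poly int}) (E : int) (K : fieldType)
    (a b : {poly K}) (c : K) :
  (0 < D)%N -> lowest_terms D a b ->
  (size A <= D.+1)%N -> (size B <= D.+1)%N ->
  (forall i, `|A`_i| <= E /\ `|B`_i| <= E) ->
  c != 0 -> map_poly intr A = c *: a -> map_poly intr B = c *: b ->
  exists r U V, [/\ r != 0, `|r| <= (D + D)`!%:R * E ^+ (D + D)
    & U * A + V * B = r%:P].
Proof.
move=> D0 lt sA sB AE c0 Aa Bb; have [sa sb cab ab] := lt.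
have ltc : lowest_terms D (c *: a) (c *: b).
  split; rewrite ?size_scale // ?coefZ ?mulf_eq0 ?(negPf c0) //.
  by rewrite coprimepZl // coprimepZr.
pose S := sylvester_form D A B; exists (\det S).
have D20 : (0 < D + D)%N by rewrite addn_gt0 D0.
pose v := row (Ordinal D20) (\adj S).
exists (rVpoly (lsubmx v)), (rVpoly (rsubmx v)); split.
- have : \det (map_mx intr S) != 0 :> K.
    rewrite (_ : map_mx _ S = sylvester_form D (c *: a) (c *: b)) ?sylvester_form_det_neq0 //.
    rewrite /S /sylvester_form map_col_mx -Aa -Bb; congr col_mx; apply/matrixP=> i j;
      by rewrite !mxE -coef_map rmorphM /= map_polyXn.
  by rewrite det_map_mx; apply: contraNneq => ->.
- have := @det_bound _ _ S (fun=> E); rewrite prodr_const card_ord; apply=> i j.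
  have E0 : 0 <= E by apply: le_trans (AE 0%N).1.
  have bd (q : {poly int}) (k : nat) (l : nat) : (forall i, `|q`_i| <= E) ->
      `|('X^k * q)`_l| <= E.
    by move=> qE; rewrite coefXnM; case: ifP => // _; rewrite normr0.
  rewrite !mxE; case: fintype.split => k; rewrite mxE; apply: bd => m; by have [] := AE m.
have := sylvester_form_mul A B v; rewrite -row_mul mul_adj_mx => /(congr1 rVpoly).
rewrite poly_rV_K ?size_sylvester ?size_poly // => <-.
apply/polyP=> i; rewrite coef_rVpoly coefC; case: insubP => [j _ <-|].
  by rewrite !mxE -val_eqE /= eq_sym; case: eqP.
by case: eqP => // ->; rewrite D20.
Qed.

(** * Points of a box on a graph modulo p *)

(** The points are roots of the nonzero polynomial obtained by multiplying the
    B ^ 2 - d ^ 2 over the divisors d of r; squares take care of the sign of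
    B(x). *)
Lemma count_divisor_values (D r : nat) (B : {poly int}) (S : seq int) :
  (1 < size B)%N -> (size B <= D.+1)%N -> (0 < r)%N -> uniq S ->
  (forall x, x \in S -> (absz (B.[x])%R %| r)%N) ->
  (size S <= D.*2 * size (divisors r))%N.
Proof.
move=> B1 sB r0 uS Sr; pose f d := B ^+ 2 - (d%:Z ^+ 2)%:P.
have szB2 : size (B ^+ 2) = ((size B).-1 * 2).+1.
  by rewrite -(size_exp B 2) prednK // lt0n size_poly_eq0 expf_eq0 /=
    -size_poly_eq0 -lt0n ltnW.
have Bm : (0 < (size B).-1)%N by case: (size B) B1 => [|[]].
have szf d : size (f d) = ((size B).-1 * 2).+1.
  rewrite /f size_polyDl szB2 // size_polyN size_polyC ltnS.
  by rewrite (leq_trans (leq_b1 _)) // muln_gt0 Bm.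
have [P0 szP] : \prod_(d <- divisors r) f d != 0 /\
    (size (\prod_(d <- divisors r) f d)%R <= (D.*2 * size (divisors r)).+1)%N.
  elim: (divisors r) => [|d ds [P0 szP]].
    by rewrite big_nil size_poly1 oner_neq0.
  rewrite big_cons; have f0 : f d != 0 by rewrite -size_poly_eq0 szf.
  rewrite mulf_neq0 // size_mul // szf addSn /=; split=> //.
  have sB' : ((size B).-1 * 2 <= D.*2)%N.
    by rewrite muln2 leq_double -ltnS prednK // ltnW.
  by rewrite (leq_trans (leq_add sB' szP)) // addnS mulnS.
rewrite -ltnS (leq_trans _ szP) //; apply: max_poly_roots => //.
apply/allP => x xS; rewrite rootE horner_prod prodf_seq_eq0; apply/hasP.
exists (absz B.[x]); first by rewrite -dvdn_divisors ?Sr.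
have sq : (absz B.[x])%:Z ^+ 2 = B.[x] ^+ 2 by rewrite abszE real_normK ?num_real.
by rewrite /f hornerD hornerN hornerC horner_exp sq subrr eqxx.
Qed.

(** Taking k large turns this into the bound H ^ (1 / D + o(1)) on the number of
    points; integral exponents make it a statement about natural numbers.  The
    factor H ^ k comes from the classes in which the points are m apart, and the
    additional H pays for the number of classes or of divisors. *)
Lemma curve_points_bound (D k : nat) : (0 < D)%N -> exists2 C : nat, (0 < C)%N &
  forall (K : fieldType) (p H : nat) (a b : {poly K}) (xys : seq (int * int)),
  p \in [pchar K] -> (0 < H)%N -> lowest_terms D a b ->
  uniq [seq z.1%:~R : K | z <- xys] ->
  (forall z, z \in xys -> `|z.1| <= H%:Z /\ `|z.2| <= H%:Z) ->
  (forall z, z \in xys -> a.[z.1%:~R] + z.2%:~R * b.[z.1%:~R] = 0) ->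
  (forall z, z \in xys -> b.[z.1%:~R] != 0) ->
  ((D.+1 + D.+1)`! * H ^ (D.+1 ^ 2) < p)%N ->
  (size xys ^ (k * D) <= C * H ^ k.+1)%N.
Proof.
move=> D0; pose n := (D + D.+1)%N; pose e := (D.+1 * n)%N.
have [C1 C10 bC1] := divisor_bound_pow (D * (k * D)) n`! e.
have [C3 C30 bC3] := divisor_bound_pow (k * D) ((D + D)`! * n`! ^ (D + D)) (e * (D + D)).
pose C2 := ((2 * D) ^ D * D.+1)%N.
exists (D.*2 ^ (k * D) + C1 * C2 ^ k + D.*2 ^ (k * D) * C3)%N.
  by rewrite addn_gt0 addn_gt0 expn_gt0 double_gt0 D0.
move=> K p H a b xys pK H0 lt uK box rel b0 Hp.
rewrite !mulnDl; have Hk : (0 < H ^ k.+1)%N by rewrite expn_gt0 H0.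
(* The lifting needs 2 D + 1 points; the other constants cover the cases of B
   constant and of B of positive degree. *)
have [small|large] := leqP (size xys) D.*2.
  rewrite -addnA (leq_trans _ (leq_addr _ _)) // (leq_trans _ (leq_pmulr _ Hk)) //.
  by rewrite leq_expn2r.
have [A [B [[sA sB] bd relZ [c [c0 Aa Bb]]]]] := lift_relation pK H0 lt large uK box rel Hp.
rewrite -/n -/e in bd.
have uS : uniq (map fst xys).
  by apply: (@map_uniq _ _ (fun x : int => x%:~R : K)); rewrite -map_comp.
have Bx z : z \in xys -> B.[z.1] != 0.
  move=> zin; apply: contra (b0 z zin) => /eqP B0.
  have : (B.[z.1])%:~R = 0 :> K by rewrite B0.
  rewrite -[_%:~R]horner_map /= Bb hornerZ => /eqP.
  by rewrite mulf_eq0 (negPf c0).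
have szS : size (map fst xys) = size xys by rewrite size_map.
have [B1|B1] := leqP (size B) 1.
  have [z0 z0in] : exists z, z \in xys.
    by case: (xys) large => // z ? _; exists z; rewrite mem_head.
  pose beta := B`_0; have BE : B = beta%:P by apply: size1_polyC.
  have Bc0 : beta != 0 by have := Bx _ z0in; rewrite BE hornerC.
  have sA' : size A = D.+1.
    apply: size_eq_coef sA _; have [_ _ _ /orP[aD|bD]] := lt.
      apply: contra aD => /eqP AD; have : (map_poly intr A)`_D = 0 :> K by rewrite coef_map AD.
      by rewrite Aa coefZ => /eqP; rewrite mulf_eq0 (negPf c0).
    have : (map_poly intr B)`_D = 0 :> K by rewrite coef_map nth_default // (leq_trans B1).
    by rewrite Bb coefZ => /eqP; rewrite mulf_eq0 (negPf c0) (negPf bD).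
  have [x /mapP[z zin ->]|c' [M [/andP[c'0 c'B] szM MD]]] := graph_poly_bound D0 Bc0 H0 sA' uS.
    exists (- z.2).
      by rewrite abszN -lez_nat abszE; have [] := box z zin.
    have := relZ z zin; rewrite BE hornerC => /eqP.
    by rewrite addr_eq0 => /eqP->; ring.
  rewrite szS in szM.
  rewrite addnAC (leq_trans _ (leq_addl _ _)) //.
  apply: (@leq_trans ((D ^ size (primes c') * M) ^ (k * D))); first by rewrite leq_expn2r.
  rewrite expnMn expnS mulnACA; apply: leq_mul.
    apply: (@leq_trans ((size (divisors c') ^ D) ^ (k * D))).
      by rewrite leq_expn2r // expn_omega_le.
    rewrite -expnM; apply: bC1 => //; apply: leq_trans c'B _.
    have [_] := bd 0%N; rewrite -lez_nat abszE => /le_trans; apply.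
    by rewrite -natrX -natrM natz.
  by rewrite mulnC expnM -expnMn leq_expn2r // (leq_trans MD) // /C2 mulnA.
have [r [U [V [r0 rB UV]]]] := bezout_det D0 lt sA sB bd c0 Aa Bb.
have rp : (0 < absz r)%N by rewrite absz_gt0.
have := count_divisor_values B1 sB rp uS.
rewrite szS => szr; have {szr} : (size xys <= D.*2 * size (divisors (absz r)))%N.
  apply: szr => x /mapP[z zin ->].
  have := congr1 (fun P : {poly int} => P.[z.1]) UV; rewrite !hornerE /= => <-.
  have -> : A.[z.1] = - (z.2 * B.[z.1]) by apply/eqP; rewrite -addr_eq0 relZ.
  have -> : U.[z.1] * - (z.2 * B.[z.1]) + V.[z.1] * B.[z.1]
            = (V.[z.1] - U.[z.1] * z.2) * B.[z.1] by ring.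
  by rewrite abszM dvdn_mull.
move=> szr; rewrite (leq_trans _ (leq_addl _ _)) //.
apply: (@leq_trans ((D.*2 * size (divisors (absz r))) ^ (k * D))); first by rewrite leq_expn2r.
rewrite expnMn -mulnA leq_mul2l; apply/orP; right.
apply: (@leq_trans (C3 * H)); last by rewrite leq_mul2l expnS leq_pmulr ?orbT // expn_gt0 H0.
apply: bC3 => //; rewrite -lez_nat abszE (le_trans rB) //.
rewrite exprMn -exprM -!natrX -!natrM natz lez_nat mulnA //.
Qed.

(** * Composition of fractions in lowest terms *)

(** The value at (x, y) of the form of degree D in two variables attached
    to f. *)
Definition homog (R : nzRingType) (D : nat) (f : {poly R}) (x y : R) : R :=
  \sum_(i < D.+1) f`_i * (x ^+ i * y ^+ (D - i)).

Definition hcomp (R : nzRingType) (D : nat) (f u v : {poly R}) : {poly R} :=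
  \sum_(i < D.+1) f`_i *: (u ^+ i * v ^+ (D - i)).

Lemma horner_hcomp (R : comNzRingType) (D : nat) (f u v : {poly R}) (x : R) :
  (hcomp D f u v).[x] = homog D f u.[x] v.[x].
Proof.
rewrite /hcomp /homog horner_sum; apply: eq_bigr => i _.
by rewrite hornerZ hornerM !horner_exp.
Qed.

Lemma homog_neq0 (K : fieldType) (D : nat) (f : {poly K}) (x y : K) :
  (size f <= D.+1)%N -> y != 0 -> homog D f x y = y ^+ D * f.[x / y].
Proof.
move=> sf y0; rewrite (horner_coef_wide _ sf) mulr_sumr; apply: eq_bigr => i _.
have iD : (i <= D)%N by rewrite -ltnS.
rewrite [RHS]mulrCA; congr (_ * _); rewrite expr_div_n.
have -> : y ^+ D = y ^+ (D - i) * y ^+ i by rewrite -exprD subnK.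
by rewrite -mulrA [y ^+ i * _]mulrC mulfVK ?expf_neq0 // mulrC.
Qed.

Lemma homog0 (K : fieldType) (D : nat) (f : {poly K}) (x : K) :
  homog D f x 0 = f`_D * x ^+ D.
Proof.
rewrite /homog big_ord_recr /= big1 ?add0r => [|i _]; first by rewrite subnn expr0 mulr1.
by rewrite expr0n subn_eq0 leqNgt ltn_ord /= !mulr0.
Qed.

(** In a field, a common zero (x, y) with y nonzero would make x / y a common root
    of f and g; one with y = 0 and x nonzero would make both coefficients of degree D
    vanish. *)
Lemma homog_common_zero (K : fieldType) (D : nat) (f g : {poly K}) (x y : K) :
  lowest_terms D f g -> homog D f x y = 0 -> homog D g x y = 0 ->
  x = 0 /\ y = 0.
Proof.
move=> [sf sg cfg fg]; have [->|y0] := eqVneq y 0.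
  rewrite !homog0 => /eqP fx /eqP gx; split=> //; apply/eqP; move: fx gx fg.
  rewrite !mulf_eq0 !expf_eq0; case: (x == 0); rewrite ?andbF ?orbF //.
  by move=> -> ->.
rewrite !homog_neq0 // => /eqP; rewrite mulf_eq0 expf_eq0 (negPf y0) andbF /=.
move=> /(coprimep_root cfg) gx /eqP; rewrite mulf_eq0 expf_eq0 (negPf y0) andbF /=.
by rewrite (negPf gx).
Qed.

Lemma coefM_top (R : nzRingType) (m n : nat) (f g : {poly R}) :
  (size f <= m.+1)%N -> (size g <= n.+1)%N ->
  (size (f * g)%R <= (m + n).+1)%N /\ (f * g)`_(m + n) = f`_m * g`_n.
Proof.
move=> sf sg; split.
  apply: leq_trans (size_polyMleq _ _) _.
  by have := leq_add sf sg; rewrite addnS addSn; case: (_ + _)%N.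
have im : (m < (m + n).+1)%N by rewrite ltnS leq_addr.
rewrite coefM (bigD1 (Ordinal im)) //= addKn big1 ?addr0 // => i im'.
have [lim|] := ltnP i m; last first.
  rewrite leq_eqVlt => /orP[/eqP mi|mi]; first by case/eqP: im'; apply: val_inj.
  by rewrite nth_default ?mul0r // (leq_trans sf).
by rewrite [X in _ * X]nth_default ?mulr0 // (leq_trans sg) // ltn_subRL ltn_add2r.
Qed.

Lemma coefX_top (R : nzRingType) (m i : nat) (f : {poly R}) :
  (size f <= m.+1)%N ->
  (size (f ^+ i)%R <= (i * m).+1)%N /\ (f ^+ i)`_(i * m) = f`_m ^+ i.
Proof.
move=> sf; elim: i => [|i [sfi cfi]].
  by rewrite !expr0 size_poly1 coef1.
by rewrite exprS mulSn; have [s c] := coefM_top sf sfi; split=> //; rewrite c cfi exprS.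
Qed.

(** The coefficient of degree D e of the composition is the form of f evaluated at
    the coefficients of degree e of u and v. *)
Lemma coef_hcomp_top (R : comNzRingType) (D e : nat) (f u v : {poly R}) :
  (size u <= e.+1)%N -> (size v <= e.+1)%N ->
  (size (hcomp D f u v) <= (D * e).+1)%N /\
  (hcomp D f u v)`_(D * e) = homog D f u`_e v`_e.
Proof.
move=> su sv; rewrite /hcomp /homog coef_sum.
have term (i : 'I_D.+1) : (size (u ^+ i * v ^+ (D - i))%R <= (D * e).+1)%N /\
    (u ^+ i * v ^+ (D - i))`_(D * e) = u`_e ^+ i * v`_e ^+ (D - i).
  have iD : (i <= D)%N by rewrite -ltnS.
  have [sui cui] := coefX_top i su; have [svi cvi] := coefX_top (D - i) sv.
  have := coefM_top sui svi; rewrite -mulnDl subnKC // => -[s c]; split=> //.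
  by rewrite c cui cvi.
split; last by apply: eq_bigr => i _; rewrite coefZ (term i).2.
apply: leq_trans (size_sum _ _ _) _; apply/bigmax_leqP => i _.
exact: leq_trans (size_scale_leq _ _) (term i).1.
Qed.

Lemma map_hcomp (R S : nzRingType) (phi : {rmorphism R -> S}) (D : nat)
    (f u v : {poly R}) :
  map_poly phi (hcomp D f u v) =
  hcomp D (map_poly phi f) (map_poly phi u) (map_poly phi v).
Proof.
rewrite /hcomp rmorph_sum; apply: eq_bigr => i _.
by rewrite /= map_polyZ rmorphM !rmorphXn /= coef_map.
Qed.

Lemma lowest_terms_map (K L : fieldType) (phi : {rmorphism K -> L}) (D : nat)
    (f g : {poly K}) :
  lowest_terms D f g -> lowest_terms D (map_poly phi f) (map_poly phi g).
Proof.
by case=> *; split; rewrite ?size_map_poly ?coprimep_map // !coef_map !fmorph_eq0.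
Qed.

(** Both clauses follow from [homog_common_zero]: for the degree, apply it to
    the top coefficients of u and v; for coprimality, to the values of u and v
    at a point of an algebraic closure. *)
Lemma lowest_terms_comp (K : countFieldType) (D e : nat) (f g u v : {poly K}) :
  lowest_terms D f g -> lowest_terms e u v ->
  lowest_terms (D * e) (hcomp D f u v) (hcomp D g u v).
Proof.
move=> fg uv; have [su sv cuv uve] := uv.
have [sF cF] := coef_hcomp_top D f su sv; have [sG cG] := coef_hcomp_top D g su sv.
split=> //; last first.
  rewrite cF cG -negb_and; apply: contraTN uve => /andP[/eqP f0 /eqP g0].
  by have [-> ->] := homog_common_zero fg f0 g0; rewrite eqxx.
have [L [phi _]] := countable_algebraic_closure K.
rewrite -(coprimep_map phi); apply/Pdiv.ClosedField.coprimepP => x.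
rewrite rootE !map_hcomp !horner_hcomp => /eqP f0; apply/eqP => g0.
have [/eqP ux /eqP vx] := homog_common_zero (lowest_terms_map phi fg) f0 g0.
by have := coprimep_root (_ : coprimep (map_poly phi u) (map_poly phi v)) ux;
  rewrite coprimep_map vx => /(_ cuv).
Qed.

(** * Paths of rational functions *)

Lemma ratdeg_lowest_terms (F : fieldType) (q : {fraction {poly F}}) (d : nat) :
  (0 < d)%N -> ratdeg q = d -> lowest_terms d (rnum q) (rden q).
Proof.
move=> d0 qd; have r20 := denom_ratioP (repr q).
have [sn sd] : (size (rnum q) <= d.+1)%N /\ (size (rden q) <= d.+1)%N.
  by split; rewrite -qd /ratdeg; [have := leq_maxl (size (rnum q)).-1 (size (rden q)).-1
    | have := leq_maxr (size (rnum q)).-1 (size (rden q)).-1]; case: (size _).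
split=> //.
  by rewrite /rnum /rden coprimep_div_gcd // r20 orbT.
have lc (f : {poly F}) : (size f).-1 = d -> f`_d != 0.
  move=> fd; rewrite -fd -lead_coefE lead_coef_eq0 -size_poly_eq0.
  by move: fd d0; case: (size f) => // <-.
move: qd; rewrite /ratdeg /maxn; case: ifP => _ /lc->; rewrite ?orbT //.
Qed.

Definition represents (R : nzRingType) (uv : {poly R} * {poly R}) (t y : R) : Prop :=
  uv.2.[t] != 0 /\ uv.1.[t] = y * uv.2.[t].

Lemma represents_hcomp (K : fieldType) (D : nat) (f g : {poly K})
    (uv : {poly K} * {poly K}) (t y : K) :
  lowest_terms D f g -> represents uv t y -> g.[y] != 0 ->
  represents (hcomp D f uv.1 uv.2, hcomp D g uv.1 uv.2) t (f.[y] / g.[y]).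
Proof.
move=> [sf sg _ _] [v0 uE] gy; rewrite /represents /= !horner_hcomp !homog_neq0 //.
rewrite uE mulfK // mulf_neq0 ?expf_neq0 //; split=> //.
by rewrite [RHS]mulrCA divfK.
Qed.

Definition iter_pair (F : fieldType) (s d : nat) (Psi : 'I_s -> {fraction {poly F}})
    (w : seq 'I_s) (uv : {poly F} * {poly F}) : {poly F} * {poly F} :=
  foldl (fun uv j => (hcomp d (rnum (Psi j)) uv.1 uv.2,
                      hcomp d (rden (Psi j)) uv.1 uv.2)) uv w.

Lemma lowest_terms_iterpair (F : countFieldType) (s d e : nat)
    (Psi : 'I_s -> {fraction {poly F}}) (w : seq 'I_s) (uv : {poly F} * {poly F}) :
  (0 < d)%N -> (forall i, ratdeg (Psi i) = d) -> lowest_terms e uv.1 uv.2 ->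
  lowest_terms (d ^ size w * e) (iter_pair d Psi w uv).1 (iter_pair d Psi w uv).2.
Proof.
move=> d0 degP; elim: w e uv => [|j w IHw] e uv lt /=; first by rewrite mul1n.
rewrite expnSr -mulnA; apply: IHw.
exact: lowest_terms_comp (ratdeg_lowest_terms d0 (degP j)) lt.
Qed.

Lemma represents_iterpair (p s d : nat) (Psi : 'I_s -> {fraction {poly 'F_p}})
    (x : nat -> 'F_p) (j : nat -> 'I_s) (n m : nat) (uv : {poly 'F_p} * {poly 'F_p})
    (t : 'F_p) :
  (0 < d)%N -> (forall i, ratdeg (Psi i) = d) ->
  (forall n, rateval_def (Psi (j n)) (x n) /\ x n.+1 = rateval (Psi (j n)) (x n)) ->
  represents uv t (x n) ->
  represents (iter_pair d Psi [seq j i | i <- iota n m] uv) t (x (n + m)%N).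
Proof.
move=> d0 degP step; elim: m n uv => [|m IHm] n uv rx /=; first by rewrite addn0.
rewrite addnS -addSn; apply: IHm; have [dj ->] := step n.
exact: represents_hcomp (ratdeg_lowest_terms d0 (degP _)) rx dj.
Qed.

(** With e = 1 this is the translation by c; with e = -1 it is x |-> - (x + c),
    whose sign turns the equation y = f(x) / g(x) into f(x) + y g(x) = 0. *)
Lemma lowest_terms_shift (F : fieldType) (c e : F) :
  e != 0 -> lowest_terms 1 ('X + c%:P) e%:P.
Proof.
move=> e0; split; rewrite ?size_XaddC ?size_polyC ?e0 //.
  by rewrite -[e%:P]mulr1 mul_polyC coprimepZr // coprimep1.
by rewrite coefD coefX coefC addr0 oner_neq0.
Qed.

(** Label each n <= N - nu by the word of the nu maps used by the path between the
    times n and n + nu; the most popular of the at most s ^ nu words gives the pair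
    (a, b), which is its composition conjugated, up to sign, by the translation by v. *)
Lemma path_on_curve (p s d nu N : nat) (Psi : 'I_s -> {fraction {poly 'F_p}})
    (u v : 'F_p) (x : nat -> 'F_p) :
  (0 < d)%N -> (forall i, ratdeg (Psi i) = d) -> is_path Psi u x ->
  uniq (mkseq x N) -> (0 < nu <= N)%N ->
  let coord n := (x n : nat)%:Z - (v : nat)%:Z in
  exists (a b : {poly 'F_p}) (ns : seq nat),
  let xys := [seq (coord n, coord (n + nu)%N) | n <- ns] in
  [/\ lowest_terms (d ^ nu) a b, uniq [seq z.1%:~R : 'F_p | z <- xys],
      forall z, z \in xys -> a.[z.1%:~R] + z.2%:~R * b.[z.1%:~R] = 0 /\ b.[z.1%:~R] != 0,
      forall n, n \in ns -> (n + nu <= N)%N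
    & (N <= nu + s ^ nu * size xys)%N].
Proof.
move=> d0 degP [_ px] ux /andP[nu0 nuN] coord.
have [j step] := choice px.
pose word n : seq 'I_s := [seq j i | i <- iota n nu].
have few : (size (undup [seq word n | n <- iota 0 (N - nu).+1]) <= s ^ nu)%N.
  have -> : (s ^ nu)%N = size (map val (enum {: nu.-tuple 'I_s})).
    by rewrite size_map -cardE card_tuple card_ord.
  apply: uniq_leq_size; first exact: undup_uniq.
  move=> w; rewrite mem_undup => /mapP[n _ ->].
  have szw : size (word n) == nu by rewrite size_map size_iota.
  by apply/mapP; exists (Tuple szw); rewrite ?mem_enum.
have [ns [sub szns same]] := popular_key few.
have leN n : n \in ns -> (n + nu <= N)%N.
  by move/(mem_subseq sub); rewrite mem_iota add0n ltnS leq_subRL // addnC.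
have [n0 n0in] : exists n, n \in ns.
  by case: (ns) szns => [|n ns' _]; [rewrite muln0 size_iota | exists n; rewrite mem_head].
pose uv := iter_pair d Psi (word n0) ('X + v%:P, 1%:P).
have lt_uv : lowest_terms (d ^ nu) uv.1 uv.2.
  have := @lowest_terms_iterpair _ _ _ _ Psi (word n0) ('X + v%:P, 1%:P) d0 degP
    (lowest_terms_shift v (oner_neq0 _)).
  by rewrite /word size_map size_iota muln1.
have N1 : -1 != 0 :> 'F_p by rewrite oppr_eq0 oner_neq0.
have lt1 := lowest_terms_shift (- v) N1.
pose a := hcomp 1 ('X + (- v)%:P) uv.1 uv.2; pose b := hcomp 1 (-1)%:P uv.1 uv.2.
have coordE n : (coord n)%:~R = x n - v :> 'F_p by rewrite /coord rmorphB /= -!pmulrn !natr_Zp.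
exists a, b, ns; split=> //.
- by have := lowest_terms_comp lt1 lt_uv; rewrite mul1n.
- rewrite -map_comp map_inj_in_uniq ?(subseq_uniq sub) ?iota_uniq // => n m nin min.
  rewrite /= !coordE => /addIr; have ltN k : k \in ns -> (k < N)%N.
    by move/leN; apply: leq_trans; rewrite -addn1 leq_add2l.
  move=> /eqP; rewrite -(nth_mkseq 0 x (ltN n nin)) -(nth_mkseq 0 x (ltN m min)).
  by rewrite nth_uniq ?size_mkseq ?ltN // => /eqP.
- move=> _ /mapP[n nin ->] /=; rewrite !coordE.
  have r0 : represents ('X + v%:P, 1%:P) (x n - v) (x n).
    by rewrite /represents /= !hornerE oner_neq0 subrK.
  have := @represents_iterpair p s d Psi x j n nu _ _ d0 degP step r0.
  rewrite -/(word n) (same n n0 nin n0in) -/uv => r1.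
  have := represents_hcomp lt1 r1; rewrite hornerC => /(_ N1)[b0 aE].
  split=> //; move: aE; rewrite -/a -/b /= => ->.
  by rewrite hornerD hornerX hornerC invrN invr1 mulrN1 mulNr addNr.
rewrite size_map; move: szns; rewrite size_iota => szns.
by rewrite -leq_subLR (leq_trans (leqnSn _)).
Qed.

Lemma Tpath_path (p s : nat) (Psi : 'I_s -> {fraction {poly 'F_p}}) (u : 'F_p) :
  (0 < Tpath Psi u)%N -> exists x, is_path Psi u x.
Proof.
rewrite /Tpath /greatest; set A := [set T | _].
case: (xgetP 0%N (A `&` ubound A)) => [T _ [AT ubT] T0|//].
apply/not_existsP => nox; suff : (T.+1 <= T)%N by rewrite ltnn.
by apply: ubT; split=> // x /nox.
Qed.

(** The path starts with two distinct points, so it cannot stay at v. *)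
Lemma Lpath_gt0 (p s : nat) (Psi : 'I_s -> {fraction {poly 'F_p}}) (u : 'F_p)
    (N : nat) :
  (1 < Tpath Psi u)%N -> (0 < N)%N -> (0 < Lpath Psi u N)%N.
Proof.
move=> T1 N0; have exx := Tpath_path (ltnW T1).
have [_ uT _] := TpathP exx; have [[x [v [px ->]]] _] := LpathP N exx.
rewrite lt0n; apply/eqP => max0.
have xv n : (n <= N)%N -> (x n : nat) = v.
  move=> nN; have : (repdist (x n) v <= 0)%N.
    by rewrite -max0; apply: (leq_bigmax (Ordinal (nN : (n < N.+1)%N))).
  by rewrite leqn0 /repdist absz_eq0 subr_eq0 => /eqP[].
(* All the points up to time N equal v, so the first two coincide. *)
have x01 : x 0%N = x 1%N by apply: val_inj; rewrite /= !xv.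
have := uT x px; move/(mkseq_uniqP x)/(_ 0%N 1%N).
by rewrite !inE (ltnW T1) T1 => /(_ isT isT x01).
Qed.

(** The points of [path_on_curve] have coordinates at most L in absolute value, so
    [curve_points_bound] applies to them. *)
Lemma path_length_bound (s d nu k : nat) : (0 < d)%N -> (0 < nu)%N ->
  exists2 C : nat, (0 < C)%N & forall (p : nat), prime p ->
  forall Psi : 'I_s -> {fraction {poly 'F_p}}, (forall i, ratdeg (Psi i) = d) ->
  forall (u : 'F_p) (N : nat),
  (1 < Tpath Psi u)%N -> (1 <= N <= Tpath Psi u)%N ->
  (((d ^ nu).+1 + (d ^ nu).+1)`! * Lpath Psi u N ^ ((d ^ nu).+1 ^ 2) < p)%N ->
  (N ^ (k * d ^ nu) <= C * Lpath Psi u N ^ k.+1)%N.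
Proof.
move=> d0 nu0; pose D := (d ^ nu)%N; have D0 : (0 < D)%N by rewrite expn_gt0 d0.
have [C C0 bC] := curve_points_bound k D0.
exists (nu ^ (k * D) + (nu + s ^ nu) ^ (k * D) * C)%N.
  by rewrite addn_gt0 expn_gt0 nu0.
move=> p p_pr Psi degP u N T1 /andP[N0 NT] Hp; rewrite -/D in Hp *.
have L0 := Lpath_gt0 T1 N0; have exx := Tpath_path (ltnW T1).
have [_ uT _] := TpathP exx; have [[x [v [px LE]]] _] := LpathP N exx.
set L := Lpath Psi u N in L0 LE Hp *.
have Lk : (0 < L ^ k.+1)%N by rewrite expn_gt0 L0.
have smallN : (N <= nu)%N ->
    (N ^ (k * D) <= (nu ^ (k * D) + (nu + s ^ nu) ^ (k * D) * C) * L ^ k.+1)%N.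
  move=> Nnu; apply: leq_trans (leq_pmulr _ Lk).
  by rewrite (leq_trans (leq_expn2r _ Nnu)) // leq_addr.
have [/smallN //|nuN] := leqP N nu.
have uN : uniq (mkseq x N).
  have := uT x px; rewrite -(subnKC NT) /mkseq iotaD map_cat cat_uniq.
  by case/andP.
have [a [b [ns [lt uz rel leN szN]]]] :=
  path_on_curve v d0 degP px uN (introT andP (conj nu0 (ltnW nuN))).
set xys := map _ ns in uz rel szN.
have near n : (n <= N)%N -> `|(x n : nat)%:Z - (v : nat)%:Z| <= L%:Z.
  move=> nN; rewrite -abszE lez_nat LE.
  exact: (leq_bigmax (F := fun n : 'I_N.+1 => repdist (x n) v) (Ordinal (nN : (n < N.+1)%N))).
have szM : (size xys ^ (k * D) <= C * L ^ k.+1)%N.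
  apply: (bC _ p L a b xys (pchar_Fp p_pr) L0 lt uz) => //.
  - by move=> _ /mapP[n nin ->]; split; apply: near;
      rewrite ?(leq_trans _ (leN n nin)) ?leq_addr ?leN.
  - by move=> z /rel[].
  - by move=> z /rel[].
have [M0|Mp] := posnP (size xys); first by apply: smallN; rewrite M0 muln0 addn0 in szN.
apply: (@leq_trans (((nu + s ^ nu) * size xys) ^ (k * D))).
  by rewrite leq_expn2r // mulnDl (leq_trans szN) // leq_add2r leq_pmulr.
rewrite expnMn mulnDl; apply: leq_trans (leq_addl _ _).
by rewrite -mulnA leq_mul2l szM orbT.
Qed.

(** * The exponent *)

(** For each N, the exponents t <= 0 for which N ^ (D + t) <= H always holds form a set
    containing - D, whose supremum tends to 0 as N grows by hypothesis.  The supremum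
    need not be attained, so 1 / (N + 1) is subtracted from it. *)
Lemma uniform_exponent (R : realType) (D : R) (P : nat -> nat -> Prop) :
  0 <= D -> (forall N H, P N H -> (1 <= H)%N) ->
  (forall eps : R, 0 < eps -> exists N0, forall N H, (N0 <= N)%N -> P N H ->
     N%:R `^ (D - eps) <= H%:R) ->
  exists2 o : nat -> R, o n @[n --> \oo] --> (0 : R) &
    forall N H, (0 < N)%N -> P N H -> N%:R `^ (D + o N) <= H%:R.
Proof.
move=> D0 H1 PD.
pose E N := [set t : R | t <= 0 /\ forall H, P N H -> N%:R `^ (D + t) <= H%:R].
have supE N : has_sup (E N).
  split; last by exists 0 => t [].
  exists (- D); split; first by rewrite oppr_le0.
  by move=> H /H1; rewrite subrr powRr0 ler1n.
exists (fun N => sup (E N) - N.+1%:R^-1); last first.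
  move=> N H N0 PNH; have e0 : 0 < N.+1%:R^-1 :> R by rewrite invr_gt0 ltr0n.
  have [t [t0 /(_ H PNH) tE] lt_t] := sup_adherent e0 (supE N).
  apply: le_trans tE; rewrite ler_powR ?ler1n //.
  by rewrite lerD2l ltW.
apply/cvgr0Pnorm_le => eps eps0; have e2 : 0 < eps / 2 by rewrite divr_gt0.
have [N0 PN0] := PD _ e2.
near=> n; have nN0 : (N0 <= n)%N by near: n; exact: nbhs_infty_ge.
have inv_n : n.+1%:R^-1 < eps / 2 :> R.
  by near: n; exact: near_infty_natSinv_lt (PosNum e2).
have sup0 : sup (E n) <= 0 by apply: ge_sup (supE n).1 _ => t [].
have supe : - (eps / 2) <= sup (E n).
  apply: ub_le_sup; first exact: (supE n).2.
  split; first by rewrite oppr_le0 ltW.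
  by move=> H; apply: PN0.
have i0 : 0 <= n.+1%:R^-1 :> R by rewrite invr_ge0 ler0n.
rewrite ler_norml [eps]splitr; move: (eps / 2) inv_n supe => h inv_n supe.
by apply/andP; split;
  [rewrite opprD lerB // ltW
  | rewrite lerBlDr (le_trans sup0) // !addr_ge0 // ltW // (le_lt_trans i0)].
Unshelve. all: by end_near. Qed.

(** Choose k with (k + 1) eps >= D + 1.  Then
    N ^ ((k + 1) (D - eps)) <= N ^ (k D - 1) <= C H ^ (k + 1) / N, and C <= N
    eventually. *)
Lemma exponent_from_powers (R : realType) (D : nat) (P : nat -> nat -> Prop) :
  (forall N H, P N H -> (1 <= H)%N) ->
  (forall k, exists C, forall N H, P N H -> (N ^ (k * D) <= C * H ^ k.+1)%N) ->
  forall eps : R, 0 < eps -> exists N0, forall N H, (N0 <= N)%N -> P N H ->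
     N%:R `^ (D%:R - eps) <= H%:R.
Proof.
move=> H1 PC eps eps0.
pose k := Num.trunc ((D%:R + 1) / eps).
have kD : (D%:R + 1) <= k.+1%:R * eps.
  by rewrite -ler_pdivrMr // ltW // truncnS_gt.
have [C bC] := PC k; exists C.+1 => N H CN PNH.
have N1 : 1 <= N%:R :> R by rewrite ler1n (leq_trans _ CN).
have Np : 0 < N%:R :> R by apply: lt_le_trans N1.
rewrite -(@ler_pXn2r _ k.+1) ?nnegrE ?powR_ge0 //.
rewrite -powR_mulrn ?powR_ge0 // -powRrM -(ler_pM2r Np).
apply: (@le_trans _ _ (N%:R `^ ((k * D)%:R))).
  rewrite -{2}[N%:R](powRr1 (ltW Np)) -powRD; last by rewrite (gt_eqF Np) implybT.
  rewrite ler_powR // natrM mulrBl [eps * _]mulrC.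
  move: kD; rewrite -natr1; set K := k%:R; set DD := D%:R; nra.
rewrite powR_mulrn ?(ltW Np) // -!natrX -natrM ler_nat.
by rewrite (leq_trans (bC _ _ PNH)) // mulnC leq_mul2l (ltnW CN) orbT.
Qed.

(** * The lower bound *)

Theorem theorem1p4 (R : realType) (s d nu : nat)
    (hs : (1 <= s)%N) (hd : (2 <= d)%N) (hnu : (1 <= nu)%N) :
  exists2 c : R, 0 < c &
  exists2 o : nat -> R, o n @[n --> \oo] --> (0 : R) &
  forall (p : nat), prime p ->
  forall Psi : 'I_s -> {fraction {poly 'F_p}},
    (forall i, ratdeg (Psi i) = d) ->
  forall (u : 'F_p) (N : nat),
    (1 < Tpath Psi u)%N -> (1 <= N <= Tpath Psi u)%N ->
    c * Num.min (N%:R `^ (d%:R ^+ nu + o N))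
                (p%:R `^ (1 / (2%:R * d%:R ^+ (2 * nu) + d%:R ^+ nu
                               - 1 / 2%:R)))
      <= (Lpath Psi u N)%:R.
Proof.
pose D := (d ^ nu)%N; have d0 : (0 < d)%N by apply: ltnW.
have D2 : (2 <= D)%N by rewrite (leq_trans hd) // -{1}[d]expn1 leq_pexp2l.
pose F := (D.+1 + D.+1)`!.
pose P N L := exists p (Psi : 'I_s -> {fraction {poly 'F_p}}) (u : 'F_p),
  [/\ prime p, forall i, ratdeg (Psi i) = d, (1 < Tpath Psi u)%N,
      (1 <= N <= Tpath Psi u)%N & L = Lpath Psi u N] /\ (F * L ^ (D.+1 ^ 2) < p)%N.
have P1 N L : P N L -> (1 <= L)%N.
  by case=> [p [Psi [u [[_ _ T1 /andP[N0 _] ->] _]]]]; apply: Lpath_gt0.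
have Ppow k : exists C, forall N L, P N L -> (N ^ (k * D) <= C * L ^ k.+1)%N.
  have [C _ bC] := path_length_bound s k d0 hnu; exists C => N L.
  by case=> [p [Psi [u [[p_pr degP T1 NT ->] Hp]]]]; apply: bC Hp.
have [dl dl0 dlP] := uniform_exponent (ler0n R D) P1 (exponent_from_powers P1 Ppow).
have F1 : (0 < F)%N by apply: fact_gt0.
have Fr1 : 1 <= F%:R :> R by rewrite ler1n.
exists F%:R^-1; first by rewrite invr_gt0 ltr0n.
exists dl => // p p_pr Psi degP u N T1 NT.
set q := _ + _ - _; set L := Lpath Psi u N.
have L0 : (0 < L)%N by case/andP: NT => N0 _; apply: Lpath_gt0.
have DR : d%:R ^+ nu = D%:R :> R by rewrite -natrX.
have qE : q = 2 * D%:R ^+ 2 + D%:R - 1 / 2 by rewrite /q mulnC exprM DR.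
have D2r : 2 <= D%:R :> R by rewrite ler_nat.
(* This is where D >= 2 is needed: for D = 1 the inequality fails. *)
have q_ge : (D.+1 ^ 2)%:R <= q.
  by rewrite qE natrX -natr1; move: D2r; set x := D%:R => x2; nra.
have q0 : 0 < q by apply: lt_le_trans q_ge; rewrite ltr0n expn_gt0.
(* With c = 1 / F, the failure of L >= c p ^ (1 / q) means (F L) ^ q < p. *)
have [big|small] := lerP (F%:R^-1 * p%:R `^ (1 / q)) L%:R.
  apply: le_trans big; rewrite ler_wpM2l ?invr_ge0 ?ler0n //.
  by rewrite ge_min lexx orbT.
have PNL : P N L.
  exists p, Psi, u; split=> //.
  rewrite -(ltr_nat R); have FL1 : 1 <= (F * L)%:R :> R by rewrite ler1n muln_gt0 F1.
  apply: (@le_lt_trans _ _ ((F * L)%:R `^ q)).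
    apply: (@le_trans _ _ ((F * L)%:R `^ (D.+1 ^ 2)%:R)); last exact: ler_powR.
    rewrite powR_mulrn ?ler0n // -natrX ler_nat expnMn leq_mul2r.
    by rewrite -{1}[F]expn1 leq_pexp2l ?orbT // expn_gt0.
  have pE : p%:R = (p%:R `^ (1 / q)) `^ q :> R.
    by rewrite -powRrM div1r mulVf ?gt_eqF // powRr1 // ler0n.
  rewrite [ltRHS]pE gt0_ltr_powR // ?nnegrE ?ler0n ?powR_ge0 //.
  by rewrite natrM -ltr_pdivlMl ?ltr0n.
have {}dlP := dlP N L (andP NT).1 PNL.
apply: le_trans dlP; rewrite DR.
apply: le_trans (_ : Num.min (N%:R `^ (D%:R + dl N)) (p%:R `^ (1 / q)) <= _).
  by rewrite ler_piMl ?le_min ?powR_ge0 // invf_le1 ?ltr0n.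
by rewrite ge_min lexx.
Qed.
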